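(* Let $\omega_k'\ge0$ be given. Let $\tilde X_G$ be the $n\times|G|$ matrix defined by $\tilde X_Gv_G=\sum_{k=1}^M(Q_{G_k\setminus G}^\perp X_{G_k\cap G})v_{G\cap G_k}$ and $\tilde Q_G$ the orthogonal projection onto the column space of $\tilde X_G$. Let $$P_G\in\arg\min_{P}\Big\{\|P\tilde Q_G^\perp\|_S:\ P=P^2=P^T\in\mathbb R^{n\times n},\ \|PQ_{G_k\setminus G}\|_S\le\omega_k'\ \forall k\Big\},$$ $$\hat\beta_G=(P_G\tilde X_G)^\dagger P_G\Big(y-\sum_{k:\,G_k\not\subseteq G}Q_{G_k\setminus G}\hat\mu_{G_k}^{(init)}\Big)\quad\text{when }\mathrm{rank}(P_G\tilde X_G)=|G|,$$ $$T_G=\frac1{\hat\sigma}\Big\|P_G\Big(y-\sum_{k:\,G_k\not\subseteq G}Q_{G_k\setminus G}\hat\mu_{G_k}^{(init)}\Big)\Big\|_2,$$ where $\hat\mu^{(init)}_{G_k}=X_{G_k}\hat\beta^{(init)}_{G_k}$, and suppose $\|P_G\tilde Q_G^\perp\|_S<1$. Suppose $\varepsilon\sim N_n(0,\sigma^2I_n)$, $\mathrm{rank}(X_G)=|G|$, the estimators $\{\hat\beta^{(init)},\hat\sigma\}$ satisfy, for a $(g,s)$ strongly group sparse $\beta^*$, $$\Big|\frac{\hat\sigma}{\sigma^*}-1\Big|+\frac1{n^{1/2}}\sum_{j=1}^M\frac{\omega_{*,j}}{\sigma}\big\|X_{G_j}\hat\beta_{G_j}^{(init)}-X_{G_j}\beta_{G_j}^*\big\|_2=O_{\mathbb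 P}\Big(\frac{s+g\log M}{n}\Big),$$ where $\omega_{*,j}=\sqrt{|G_j|/n}+\sqrt{(2/n)\log M}$ and $\sigma^*=\|y-X\beta^*\|_2/\sqrt n$, and, as $n\to\infty$, $$\frac{|G|}{n}\to0,\qquad\frac{s+g\log M}{n^{1/2}}\Big(\frac{|G|^{1/2}}{n^{1/2}}+\max_{k:\,G_k\not\subseteq G}\frac{\omega_k'}{\omega_{*,k}}\Big)\to0 .$$ Let $k_G=\mathrm{rank}(P_G)$, $\hat\mu_G=\tilde X_G\hat\beta_G$ and $\mu_G^*=\tilde X_G\beta_G^*$. Then $$\sup_t\Big|\mathbb P\big\{\|P_G\tilde X_G(\hat\beta_G-\beta_G^* )\|_2^2\le\hat\sigma^2t\big\}-\mathbb P\{\chi^2_{k_G}\le t\}\Big|\to0,$$ $$\sup_t\Big|\mathbb P\big\{\|P_G\tilde Q_G(\hat\mu_G-\mu_G^* )\|_2^2\le\hat\sigma^2t\big\}-\mathbb P\{\chi^2_{k_G}\le t\}\Big|\to0,$$ if $\mu_G^*=0$ then $\sup_t\big|\mathbb P\{T_G^2\le t\}-\mathbb P\{\chi^2_{k_G}\le t\}\big|\to0$, and $$(P_G\tilde Q_G)(\hat\mu_G-\mu_G^* )/\hat\sigma=(P_G\tilde X_G)(\hat\beta_G-\beta_G^* )/\hat\sigma=N_n(0,P_G)+o_{\mathbb P}(1).$$ (The assertions involving $\hat\beta_G$ and $\hat\mu_G$ concern the case $\mathrm{rank}(P_G\tilde X_G)=|G|$ in which $\hat\beta_G$ is defined.)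
   Context: Model: $y=X\beta^*+\varepsilon$, $X\in\mathbb R^{n\times p}$ (treated as fixed), $\beta^*\in\mathbb R^p$, $\sigma>0$ unknown. The index set $\{1,\dots,p\}$ is partitioned into given disjoint groups $G_1,\dots,G_M$; $G\subset\{1,\dots,p\}$ is a given nonempty variable group of interest, not necessarily a union of the $G_j$. Asymptotics are as $n\to\infty$; $p,M,X,G_j,G,\beta^*,\sigma,g,s$ may all depend on $n$. Notation: for $A\subset\{1,\dots,p\}$, $u_A$ is the subvector of $u$ with indices in $A$, $X_A$ the submatrix of $X$ with columns in $A$, $Q_A$ the orthogonal projection in $\mathbb R^n$ onto the column space of $X_A$ ($Q_\emptyset=0$), $Q_A^\perp=I_n-Q_A$, $\tilde Q_G^\perp=I_n-\tilde Q_G$. $\|\cdot\|_S$ is the spectral norm and $\dagger$ the Moore–Penrose inverse. A maximum over the empty set is $0$. $P_G$ depends on $X$ only. Strong group sparsity: $\beta^*$ is $(g,s)$ strongly group sparse if there is $S^*\subset\{1,\dots,M\}$ with $|S^*|\le g$, $|G_{S^*}|\le s$ and $\mathrm{supp}(\beta^* )\subset G_{S^*}:=\bigcup_{j\in S^*}G_j$. $\chi^2_k$ is a chi-squared variable with $k$ degrees of freedom ($\chi^2_0=0$). ''$V=N_n(0,P_G)+o_{\mathbb P}(1)$'' means that $V=\xi+r$ with $\xi\sim N_n(0,P_G)$ and $\|r\|_2\to0$ in probability. *)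

(* Defs.v *)
(* MathComp / MathComp-Analysis; real numbers are an arbitrary [R : realType]. *)
From HB Require Import structures.
From mathcomp Require Import all_boot all_order all_algebra.
From mathcomp Require Import all_classical all_reals all_analysis.

Set Implicit Arguments.
Unset Strict Implicit.
Unset Printing Implicit Defensive.

Import Order.TTheory GRing.Theory Num.Theory.
Import numFieldNormedType.Exports.

Local Open Scope classical_set_scope.
Local Open Scope ring_scope.

Section LinearAlgebra.
Context {R : realType}.

Definition norm2 {m : nat} (u : 'cV[R]_m) : R :=
  Num.sqrt (\sum_(i < m) u i 0 ^+ 2).

(* Operator norm for the Euclidean norms; the set is nonempty and bounded, so
   [sup] is its genuine supremum. *)
Definition spectral_norm {m n : nat} (A : 'M[R]_(m, n)) : R :=
  sup [set norm2 (A *m u) | u in [set u : 'cV[R]_n | norm2 u <= 1]].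

(* Moore-Penrose inverse, computed from the full-rank factorization
   [A = col_base A *m row_base A]; the four Penrose equations are proved below.
   The library's [pinvmx] is only a one-sided partial inverse. *)
Definition mp_inv {m n : nat} (A : 'M[R]_(m, n)) : 'M[R]_(n, m) :=
  let C := col_base A in let F := row_base A in
  F^T *m invmx (F *m F^T) *m (invmx (C^T *m C) *m C^T).

Definition proj_col {m n : nat} (A : 'M[R]_(m, n)) : 'M[R]_m := A *m mp_inv A.

Lemma gram_unit {m n : nat} (F : 'M[R]_(m, n)) :
  row_free F -> F *m F^T \in unitmx.
Proof.
move=> fF; rewrite -row_free_unit -kermx_eq0; apply/eqP/row_matrixP => i.
rewrite row0; set u := row i _.
have uFF : u *m (F *m F^T) = 0.
  by apply/sub_kermxP; rewrite row_sub.
have : (u *m F) *m (u *m F)^T = 0 by rewrite trmx_mul mulmxA -(mulmxA u) uFF mul0mx.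
move=> /matrixP/(_ 0 0); rewrite !mxE => /eqP.
rewrite psumr_eq0; last by move=> j _; rewrite [X in _ * X]mxE -expr2 sqr_ge0.
move=> /allP h.
apply: (row_free_inj fF); rewrite mul0mx; apply/rowP => j; rewrite !mxE.
have := h j (mem_index_enum _); rewrite [X in _ * X]mxE -expr2 sqrf_eq0 => /eqP.
by rewrite mxE.
Qed.

Section Penrose.
Context {m n : nat} (A : 'M[R]_(m, n)).

Let penrose r (C : 'M[R]_(m, r)) (F : 'M[R]_(r, n))
    (B := F^T *m invmx (F *m F^T) *m (invmx (C^T *m C) *m C^T)) :
    A = C *m F -> C^T *m C \in unitmx -> F *m F^T \in unitmx ->
  [/\ A *m B *m A = A, B *m A *m B = B,
      (A *m B)^T = A *m B & (B *m A)^T = B *m A].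
Proof.
move=> -> uC uF.
have AB : C *m F *m B = C *m invmx (C^T *m C) *m C^T.
  rewrite /B -!mulmxA; congr (C *m _).
  by rewrite !mulmxA mulmxV // mul1mx.
have BA : B *m (C *m F) = F^T *m invmx (F *m F^T) *m F.
  rewrite /B -!mulmxA; congr (F^T *m (_ *m _)).
  by rewrite (mulmxA C^T) mulmxA mulVmx // mul1mx.
split.
- rewrite AB -!mulmxA; congr (C *m _).
  by rewrite (mulmxA C^T) mulmxA mulVmx // mul1mx.
- rewrite BA /B -!mulmxA; congr (F^T *m (_ *m _)).
  by rewrite (mulmxA F) mulmxA mulmxV // mul1mx.
- by rewrite AB !trmx_mul trmxK trmx_inv trmx_mul trmxK mulmxA.
- by rewrite BA !trmx_mul trmxK trmx_inv trmx_mul trmxK mulmxA.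
Qed.

Lemma mp_invP : [/\ A *m mp_inv A *m A = A,
  mp_inv A *m A *m mp_inv A = mp_inv A,
  (A *m mp_inv A)^T = A *m mp_inv A & (mp_inv A *m A)^T = mp_inv A *m A].
Proof.
apply: penrose; first by rewrite mulmx_base.
  rewrite -[X in _ *m X]trmxK; apply: gram_unit.
  by rewrite /row_free mxrank_tr; exact: col_base_full.
by apply: gram_unit; exact: row_base_free.
Qed.

Lemma proj_col_tr : (proj_col A)^T = proj_col A. Proof. by case: mp_invP. Qed.

Lemma proj_col_idem : proj_col A *m proj_col A = proj_col A.
Proof. by rewrite /proj_col mulmxA; case: mp_invP => ->. Qed.

Lemma proj_col_range : ((proj_col A)^T :=: A^T)%MS.
Proof.
have AE : A^T = A^T *m (proj_col A)^T.
  by rewrite -trmx_mul; case: mp_invP => ->.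
apply/eqmxP/andP; split; first by rewrite /proj_col trmx_mul submxMl.
by rewrite {1}AE submxMl.
Qed.

End Penrose.

(* Given a set [A] of column indices, a vector indexed by [A] is an element of
   ['cV_#|A|], through the increasing enumeration of [A]. *)
Definition subvec {p : nat} (A : {set 'I_p}) (u : 'cV[R]_p) : 'cV[R]_#|A| :=
  \col_a u (enum_val a) 0.

Definition subcols {n p : nat} (A : {set 'I_p}) (X : 'M[R]_(n, p)) :
  'M[R]_(n, #|A|) := \matrix_(i, a) X i (enum_val a).

(* The restriction v_B |-> v_A, for A included in B. *)
Definition restr_mx {p : nat} (A B : {set 'I_p}) : 'M[R]_(#|A|, #|B|) :=
  \matrix_(a, b) (enum_val a == enum_val b)%:R.

Lemma restr_mxE {p : nat} (A B : {set 'I_p}) (u : 'cV[R]_p) :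
  A \subset B -> restr_mx A B *m subvec B u = subvec A u.
Proof.
move=> AB; apply/colP => a; rewrite !mxE.
have aB : enum_val a \in B by apply: (fintype.subsetP AB); exact: enum_valP.
rewrite (bigD1 (enum_rank_in aB (enum_val a))) //= big1 => [|b ba].
  by rewrite !mxE enum_rankK_in // eqxx mul1r addr0.
rewrite !mxE; case: eqP => [e|_]; last by rewrite mul0r.
by case/eqP: ba; apply: enum_val_inj; rewrite enum_rankK_in.
Qed.

End LinearAlgebra.

Section GroupModel.
Context {R : realType} {n p M : nat}.
Implicit Types (X : 'M[R]_(n, p)) (Gr : 'I_M -> {set 'I_p}) (G : {set 'I_p}).

Definition is_grouping Gr : Prop :=
  injective Gr /\ finset.partition [set Gr j | j : 'I_M]%SET [set: 'I_p]%SET.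

Definition strongly_group_sparse Gr (g s : nat) (beta : 'cV[R]_p) : Prop :=
  exists S : {set 'I_M},
    [/\ (#|S| <= g)%N, (#|(\bigcup_(j in S) Gr j)%SET| <= s)%N &
        forall i, beta i 0 != 0 -> i \in (\bigcup_(j in S) Gr j)%SET].

Definition Qproj X (A : {set 'I_p}) : 'M[R]_n := proj_col (subcols A X).

Definition Xtilde X Gr G : 'M[R]_(n, #|G|) :=
  \sum_(k < M) (1%:M - Qproj X (Gr k :\: G)) *m subcols (Gr k :&: G) X
               *m restr_mx (Gr k :&: G) G.

Lemma XtildeE X Gr G (v : 'cV[R]_p) :
  Xtilde X Gr G *m subvec G v =
  \sum_(k < M) (1%:M - Qproj X (Gr k :\: G)) *m subcols (Gr k :&: G) X
               *m subvec (Gr k :&: G) v.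
Proof.
rewrite mulmx_suml; apply: eq_bigr => k _; rewrite -!mulmxA.
by rewrite restr_mxE ?finset.subsetIr.
Qed.

Definition Qtilde X Gr G : 'M[R]_n := proj_col (Xtilde X Gr G).

Definition feasible X Gr G (omega' : 'I_M -> R) (P : 'M[R]_n) : Prop :=
  [/\ P = P *m P, P = P^T &
      forall k, spectral_norm (P *m Qproj X (Gr k :\: G)) <= omega' k].

Definition is_argmin X Gr G (omega' : 'I_M -> R) (P : 'M[R]_n) : Prop :=
  feasible X Gr G omega' P /\
  forall P', feasible X Gr G omega' P' ->
    spectral_norm (P *m (1%:M - Qtilde X Gr G)) <=
    spectral_norm (P' *m (1%:M - Qtilde X Gr G)).

(* X_A u_A *)
Definition group_fit X (A : {set 'I_p}) (u : 'cV[R]_p) : 'cV[R]_n :=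
  subcols A X *m subvec A u.

Definition corrected_response X Gr G (y : 'cV[R]_n) (binit : 'cV[R]_p) :
  'cV[R]_n :=
  y - \sum_(k < M | ~~ (Gr k \subset G))
        Qproj X (Gr k :\: G) *m group_fit X (Gr k) binit.

Definition betahat X Gr G (P : 'M[R]_n) (y : 'cV[R]_n) (binit : 'cV[R]_p) :
  'cV[R]_#|G| :=
  mp_inv (P *m Xtilde X Gr G) *m (P *m corrected_response X Gr G y binit).

Definition Tstat X Gr G (P : 'M[R]_n) (y : 'cV[R]_n) (binit : 'cV[R]_p)
  (sigmahat : R) : R :=
  sigmahat^-1 * norm2 (P *m corrected_response X Gr G y binit).

End GroupModel.

Definition omega_star {R : realType} (n p M : nat) (Gr : 'I_M -> {set 'I_p})
    (j : 'I_M) : R :=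
  Num.sqrt (#|Gr j|%:R / n%:R) + Num.sqrt (2 / n%:R * ln M%:R).

Section StdNormal.
Context {R : realType}.

(* N(0, 1) as a probability on [R] with its canonical Borel structure; the
   library's [normal_prob] lives on the alias [measurableTypeR R], which has the
   same measurable sets but another display. *)
Definition std_normal : set R -> \bar R := normal_prob 0 1.

Let std_normal0 : std_normal set0 = 0%E.
Proof. exact: (measure0 (normal_prob (0 : R) 1)). Qed.

Let std_normal_ge0 A : (0 <= std_normal A)%E.
Proof. exact: (measure_ge0 (normal_prob (0 : R) 1)). Qed.

Let std_normal_sigma_additive : semi_sigma_additive std_normal.
Proof. exact: (@measure_semi_sigma_additive _ _ _ (normal_prob (0 : R) 1)). Qed.

HB.instance Definition _ := isMeasure.Build _ _ _ std_normal
  std_normal0 std_normal_ge0 std_normal_sigma_additive.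

Let std_normal_setT : std_normal [set: R] = 1%E.
Proof. exact: (probability_setT (normal_prob (0 : R) 1)). Qed.

HB.instance Definition _ :=
  Measure_isProbability.Build _ _ _ std_normal std_normal_setT.

End StdNormal.

Section Distributions.
Context {R : realType}.

Definition tuple_of_cV {n : nat} (u : 'cV[R]_n) : n.-tuple R :=
  [tuple u i 0 | i < n].
Definition cV_of_tuple {n : nat} (z : n.-tuple R) : 'cV[R]_n :=
  \col_i tnth z i.

Definition cons_pair {k : nat} (u : R * k.-tuple R) : k.+1.-tuple R :=
  [tuple of u.1 :: u.2].

Lemma measurable_cons_pair {k : nat} :
  measurable_fun [set: R * k.-tuple R] (@cons_pair k).
Proof. exact: measurable_cons. Qed.

HB.instance Definition _ (k : nat) :=
  isMeasurableFun.Build _ _ _ _ (@cons_pair k) (@measurable_cons_pair k).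

(* The law of k independent N(0, 1) variables. *)
Fixpoint std_gaussian (k : nat) : probability (k.-tuple R) R :=
  match k with
  | 0 => \d_([tuple] : 0.-tuple R)
  | k'.+1 =>
      distribution (std_normal \x std_gaussian k')%E (@cons_pair k')
  end.

Definition chi2 (k : nat) : set R -> \bar R :=
  pushforward (std_gaussian k) (fun z => \sum_(i < k) tnth z i ^+ 2).

(* xi ~ N_n(0, Sigma): xi has the law of A z with A A^T = Sigma and z a standard
   Gaussian vector of some dimension. Sigma may be singular. *)
Definition is_gaussian {d} {T : measurableType d} (P : probability T R)
    {n : nat} (xi : T -> 'cV[R]_n) (Sigma : 'M[R]_n) : Prop :=
  measurable_fun [set: T] (fun w => tuple_of_cV (xi w)) /\
  exists (m : nat) (A : 'M[R]_(n, m)), A *m A^T = Sigma /\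
    forall B : set (n.-tuple R), measurable B ->
      P [set w | B (tuple_of_cV (xi w))] =
      std_gaussian m [set z | B (tuple_of_cV (A *m cV_of_tuple z))].

End Distributions.

Section Asymptotics.
Context {R : realType} {d : nat -> measure_display}
  {T : forall n, measurableType (d n)} (P : forall n, probability (T n) R).

(* V_n = O_P(a_n); the multiplicative form allows a_n = 0. *)
Definition bigO_prob (V : forall n, T n -> R) (a : nat -> R) : Prop :=
  forall e : R, 0 < e -> exists2 C : R, 0 < C &
    \forall n \near \oo, (P n [set w | (C * a n < `|V n w|)%R] <= e%:E)%E.

(* ||r_n||_2 -> 0 in probability as n -> oo along D. *)
Definition small_prob (D : set nat) (r : forall n, T n -> 'cV[R]_n) : Prop :=
  forall e : R, 0 < e ->
    (fun n => P n [set w | (e <= norm2 (r n w))%R]) @ within D \oo --> 0%E.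

(* sup_t |P_n(E_n(t)) - P(chi2_{k_n} <= t)| -> 0 as n -> oo along D. *)
Definition chi2_limit (D : set nat) (E : forall n, R -> set (T n))
    (k : nat -> nat) : Prop :=
  (fun n => ereal_sup [set `|P n (E n t) - chi2 (k n) [set x | (x <= t)%R]|%E
                      | t in [set: R]]) @ within D \oo --> 0%E.

End Asymptotics.

(* Main.v *)
Require Import Defs.
From HB Require Import structures.
From mathcomp Require Import all_boot all_order all_algebra.
From mathcomp Require Import all_classical all_reals all_analysis.
From mathcomp Require Import measurable_realfun.
From mathcomp Require Import ring lra.

Set Implicit Arguments.
Unset Strict Implicit.
Unset Printing Implicit Defensive.

Import Order.TTheory GRing.Theory Num.Theory.
Import numFieldNormedType.Exports.

Local Open Scope classical_set_scope.
Local Open Scope ring_scope.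

(* Since Q_{G_k \ G}^perp X_{G_k} beta = Q_{G_k \ G}^perp X_{G_k cap G} beta, the
   corrected response minus [X~_G beta_G] is [eps] plus terms
   [Q_{G_k \ G} (mu_k - mu_k^init)], which [P_G] shrinks by [omega'_k]. Hence all
   statistics are norms of [V = P_G (eps + remainder) / sigmahat], and the rate
   assumptions give [|V - P_G eps / sigma| -> 0] in probability, because
   [rank P_G <= |G|] makes the error of [sigmahat] multiply only [O(sqrt |G|)].

   As the rank may vary, passing to [P(|V|^2 <= t)] uniformly in [t] requires that
   the norm of a standard Gaussian vector of R^k puts uniformly small mass on short
   intervals, for all [k >= 1] at once. This follows from Stein's identity
   [E S phi(S) = k E phi(S) + 2 E S phi'(S)] for [S = |z|^2], which for [phi = 1] and
   [phi = id] also yields the moments of chi^2_k.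

   That [|P_G eps / sigma|^2] is chi^2 for a noise given as a linear image of a
   standard Gaussian vector of any dimension comes from invariance under Givens
   rotations, themselves products of shears. *)

(** * Gaussian densities and Stein's identity *)

(** Uniformity in the rank decides the method. For [S = |z|^2] the shell [r <= sqrt S <= r + delta]
    has width about [2 r delta] in [S], and Stein's identity bounds its mass by a multiple of
    [r delta E|S - k| / r^2]. Since [E|S - k|] is of order [sqrt k] and [r] is at least a fixed
    multiple of [sqrt k] in the range where this is used, the powers of [k] cancel and [delta] can
    be chosen without [k]. No chi-square density occurs: the law is only a pushforward of a
    recursively built product.

    The bound on the rank is where [|P_G Q~_G^perp| < 1] is spent: it forbids a nonzero vector in
    the range of [P_G] that [Q~_G] kills. A relative error [c] of the scale is multiplied by
    [|P_G eps / sigma|], of order [sqrt |G|], so [c] has to be a small multiple of [1 / sqrt |G|].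
    That [|eps|^2 / (n sigma^2)] is this close to 1 costs, by Chebyshev, a multiple of [|G| / n].
    Rank 0 has no anticoncentration; there the two laws are equal. *)

Section Density.
Context {R : realType}.
Local Notation mu := (@lebesgue_measure R).
Local Open Scope ereal_scope.

(** The Radon-Nikodym derivative of the normal law agrees almost everywhere with the density,
    because both have the same integral over every measurable set. *)
Lemma ge0_integral_normal_prob (m s : R) (f : R -> \bar R) :
  measurable_fun [set: R] f -> (forall x, 0 <= f x) ->
  \int[normal_prob m s]_x f x = \int[mu]_x (f x * (normal_pdf m s x)%:E).
Proof.
move=> mf f0.
have dom : normal_prob m s `<< mu by exact: normal_prob_dominates.
rewrite -(Radon_Nikodym_SigmaFinite.change_of_variables dom)//.
have mpdf : measurable_fun [set: R] (EFin \o normal_pdf m s).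
  by apply: measurableT_comp => //; exact: measurable_normal_pdf.
apply: ae_eq_integral => //.
- apply: emeasurable_funM => //.
  exact: measurable_int (Radon_Nikodym_SigmaFinite.f_integrable dom).
- exact: emeasurable_funM.
- apply: ae_eqe_mul2l; apply: integral_ae_eq => //.
  + exact: Radon_Nikodym_SigmaFinite.f_integrable.
  + by move=> A AE mA; rewrite -Radon_Nikodym_SigmaFinite.f_integral.
Qed.

Lemma ge0_integral_std_normal (f : R -> \bar R) :
  measurable_fun [set: R] f -> (forall x, 0 <= f x) ->
  \int[std_normal]_x f x = \int[mu]_x (f x * (normal_pdf 0 1 x)%:E).
Proof.
move=> mf f0; rewrite -ge0_integral_normal_prob//.
(* The two normal laws live on copies of the line with different displays; the identity map pushes
   one to the other and carries the integral across. *)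
pose iota : measurableTypeR R -> R := idfun.
have miota : measurable_fun [set: measurableTypeR R] iota.
  move=> _ A mA. rewrite setTI.  exact: mA.
transitivity (\int[pushforward (normal_prob 0 1) iota]_x f x).
  exact: eq_measure_integral.
by rewrite ge0_integral_pushforward// preimage_setT.
Qed.

(** The pushforward of Lebesgue measure by a translation has the right value on the intervals []b,
    c]], and these determine the measure. *)
Lemma ge0_integral_lebesgue_shift (f : R -> \bar R) (a : R) :
  measurable_fun [set: R] f -> (forall x, 0 <= f x) ->
  \int[mu]_x f (x + a)%R = \int[mu]_x f x.
Proof.
move=> mf f0.
have ms : measurable_fun [set: measurableTypeR R]
  ((fun x => x + a)%R : _ -> measurableTypeR R) by exact: measurable_funD.
transitivity (\int[pushforward mu
    ((fun x => x + a)%R : measurableTypeR R -> measurableTypeR R)]_x f x).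
  by rewrite ge0_integral_pushforward// preimage_setT.
apply: eq_measure_integral => //= A mA _; apply/esym.
have := @lebesgue_measure_unique R (pushforward mu
    ((fun x => x + a)%R : measurableTypeR R -> measurableTypeR R)).
apply => // _ [[b c]] _ <-.
transitivity (mu `](b - a)%R, (c - a)%R]).
  rewrite !lebesgue_measure_itv/= !lte_fin ltrD2r.
  by case: ifPn => // _; rewrite -!EFinB; congr EFin; ring.
congr (mu _); apply/seteqP; split => x /=; by rewrite !in_itv/= ltrBlDr lerBrDr.
Qed.

End Density.

Section Stein1.
Context {R : realType}.
Local Notation mu := (@lebesgue_measure R).

Lemma std_normal_pdfE :
  normal_pdf 0 1 = (fun x : R => normal_peak 1 * expR (- x ^+ 2 / 2)).
Proof.
apply/funext => x; rewrite normal_pdfE ?oner_eq0// /normal_fun subr0.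
by rewrite expr1n.
Qed.

(** Test functions for Stein's identity, with [phi'] the derivative. Sign and growth are asked only
    on the half-line where squared norms live: nonnegativity gives every integral a meaning in the
    extended reals, and linear growth kills the boundary terms. *)
Definition stein_class (phi phi' : R -> R) :=
  [/\ (forall x : R, is_derive x 1 phi (phi' x)), continuous phi',
      (exists A, forall x, 0 <= x -> 0 <= phi x <= A * (1 + x)) &
      (forall x, 0 <= x -> 0 <= phi' x)].

(** Used with [c] the squared norm of the coordinates held fixed, so that the identity can be
    applied to one block of coordinates at a time. *)
Lemma stein_class_shift phi phi' (c : R) : 0 <= c -> stein_class phi phi' ->
  stein_class (fun x => phi (x + c)) (fun x => phi' (x + c)).
Proof.
move=> c0 [dphi cphi' [A Aphi] phi'0]; split.
- move=> x; rewrite -[phi' _]mulr1.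
  have h : is_derive x 1 (fun x => x + c) 1.
    by rewrite -[X in is_derive _ _ _ X]addr0; apply: is_deriveD.
  by apply: (@is_derive1_comp R phi (fun x => x + c) x).
- move=> x; apply: continuous_comp; last exact: cphi'.
  by apply: cvgD; [exact: cvg_id|exact: cvg_cst].
- exists (A * (1 + c)) => x x0.
  have /andP[-> h] := Aphi _ (addr_ge0 x0 c0) => /=.
  apply: (le_trans h); rewrite -mulrA ler_wpM2l//; last nra.
  have := Aphi 0 (lexx _); rewrite addr0 mulr1 => /andP[]; exact: le_trans.
- by move=> x x0; apply: phi'0; rewrite addr_ge0.
Qed.

Lemma cvg_integral_itv_sym (f : R -> R) : measurable_fun [set: R] f ->
  (forall x, 0 <= f x) ->
  (\int[mu]_(x in `[(- n.+1%:R)%R, n.+1%:R]) (f x)%:E @[n --> \oo] -->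
   \int[mu]_x (f x)%:E)%E.
Proof.
move=> mf f0.
have -> : [set: R] = \bigcup_n `[- n.+1%:R, n.+1%:R : R]%classic.
  apply/seteqP; split => // x _; exists (Num.trunc `|x|) => //=.
  rewrite in_itv/= -ler_norml.
  by have /andP[_ /ltW] := trunc_itv (normr_ge0 x).
apply: ge0_nondecreasing_set_cvg_integral.
- move=> a b ab; rewrite subsetEset; apply: subset_itv;
    by rewrite bnd_simp ?lerN2 ler_nat ltnS.
- by [].
- by move=> i; apply/measurable_EFinP; exact: measurable_funTS.
- by move=> i x _; rewrite lee_fin.
Qed.

Lemma cvg_stein_boundary phi phi' : stein_class phi phi' ->
  (n.+1%:R * phi (n.+1%:R ^+ 2) * normal_pdf 0 1 n.+1%:R : R) @[n --> \oo]
    --> (0 : R).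
Proof.
move=> [_ _ [A Aphi] _].
have A0 : 0 <= A by have := Aphi 0 (lexx _); rewrite addr0 mulr1 => /andP[]; exact: le_trans.
set q : R := normal_peak 1.
have q0 : 0 <= q by exact: normal_peak_ge0.
apply: (@squeeze_cvgr _ _ _ _ (fun=> 0) (fun n => 64 * A * q * n.+1%:R^-1)).
- near=> n; rewrite std_normal_pdfE -/q; set y : R := n.+1%:R.
  have y1 : 1 <= y by rewrite ler1n.
  have y0 : 0 < y by lra.
  have /andP[p0 pA] := Aphi (y ^+ 2) (sqr_ge0 _).
  rewrite !mulr_ge0 ?expR_ge0 ?(ltW y0)//=.
  have e0 : 0 < 1 + y ^+ 2 / 8 by nra.
  (* This is [1 + x <= exp x] at [x = y^2 / 8], raised to the fourth power. Two of the four factors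
     suffice, since the polynomial part has degree three in [y]; what remains is [O(1 / y)]. *)
  have eb : expR (- y ^+ 2 / 2) <= (1 + y ^+ 2 / 8) ^- 4.
    have -> : - y ^+ 2 / 2 = - (y ^+ 2 / 8 *+ 4) by rewrite mulNr; congr (- _); lra.
    rewrite expRN lef_pV2 ?posrE ?expR_gt0 ?exprn_gt0//.
    by rewrite -[_ *+ 4]mulr_natl expRM_natl lerXn2r ?nnegrE ?expR_ge0 ?(ltW e0) ?expR_ge1Dx.
  have eb2 : expR (- y ^+ 2 / 2) <= (1 + y ^+ 2 / 8)^-1 * (1 + y ^+ 2 / 8)^-1.
    apply: (le_trans eb); rewrite -invfM -expr2 lef_pV2 ?posrE ?exprn_gt0//.
    by rewrite ler_weXn2l//; nra.
  have h1 : 1 + y ^+ 2 <= 8 * (1 + y ^+ 2 / 8) by nra.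
  have h2 : (1 + y ^+ 2 / 8)^-1 <= 8 * y^-1 * y^-1.
    rewrite -ler_pV2 ?unitfE ?posrE ?invr_gt0 ?mulr_gt0 ?invr_gt0// ?gt_eqF//;
      rewrite ?inE ?unitfE ?gt_eqF ?mulr_gt0 ?invr_gt0//.
    rewrite invrK !invfM !invrK; nra.
  apply: (@le_trans _ _ (y * (A * (8 * (1 + y ^+ 2 / 8))) *
     (q * ((1 + y ^+ 2 / 8)^-1 * (1 + y ^+ 2 / 8)^-1)))).
    apply: ler_pM => //; rewrite ?mulr_ge0 ?expR_ge0 ?(ltW y0)//.
    - rewrite ler_pM2l//; apply: (le_trans pA); exact: ler_wpM2l.
    - exact: ler_wpM2l.
  have -> : y * (A * (8 * (1 + y ^+ 2 / 8))) *
     (q * ((1 + y ^+ 2 / 8)^-1 * (1 + y ^+ 2 / 8)^-1)) =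
     8 * A * q * y * (1 + y ^+ 2 / 8)^-1 by field; rewrite gt_eqF//; nra.
  apply: (@le_trans _ _ (8 * A * q * y * (8 * y^-1 * y^-1))).
    by rewrite ler_wpM2l// !mulr_ge0// ltW.
  rewrite le_eqVlt; apply/orP; left; apply/eqP; field.
  by rewrite gt_eqF.
- exact: cvg_cst.
- rewrite -[X in _ --> X](mulr0 (64 * A * q)); apply: cvgMr.
  exact: cvg_harmonic.
Unshelve. all: by end_near. Qed.

End Stein1.

Section Stein1b.
Context {R : realType}.
Local Notation mu := (@lebesgue_measure R).

Lemma is_derive_std_normal_pdf (x : R) :
  is_derive x 1 (normal_pdf 0 1) (- x * normal_pdf 0 1 x).
Proof.
rewrite std_normal_pdfE.
have h : is_derive x 1 (fun x : R => - x ^+ 2 / 2) (- x).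
  rewrite (_ : (fun x : R => _) = (- 2^-1) \*: (fun x : R => x ^+ 2)); last first.
    by apply/funext => y /=; rewrite /GRing.scale/=; ring.
  apply: is_derive_eq.
  by rewrite /GRing.scale/= ?expr1; field.
have h2 := @is_derive1_comp R expR (fun x : R => - x ^+ 2 / 2) x _ _ (is_derive_expR _) h.
have h3 := is_deriveZ (normal_peak 1) h2.
apply: (is_derive_eq h3); rewrite /GRing.scale/=; ring.
Qed.

(** The difference of the two sides of the one-dimensional identity, before integration, is an exact
    derivative. *)
Lemma is_derive_stein phi phi' (x : R) : stein_class phi phi' ->
  is_derive x 1 (fun x => x * phi (x ^+ 2) * normal_pdf 0 1 x)
    ((phi (x ^+ 2) + 2 * x ^+ 2 * phi' (x ^+ 2) - x ^+ 2 * phi (x ^+ 2)) *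
     normal_pdf 0 1 x).
Proof.
move=> [dphi _ _ _].
have h : is_derive x 1 (fun x : R => x ^+ 2) (2 * x).
  by apply: is_derive_eq; rewrite /GRing.scale/= ?expr1; ring.
have h1 := @is_derive1_comp R phi (fun x : R => x ^+ 2) x _ _ (dphi _) h.
have h2 := is_deriveM (is_derive_id x 1) h1.
have h3 := is_deriveM h2 (is_derive_std_normal_pdf x).
apply: (is_derive_eq h3); rewrite /GRing.scale/= /comp/= [X in X * (- x * _)](_ : _ = x * phi (x ^+ 2))//; ring.
Qed.

Lemma stein_class_continuous phi phi' : stein_class phi phi' ->
  continuous (phi : R -> R).
Proof.
move=> [dphi _ _ _] x; apply/differentiable_continuous/derivable1_diffP.
by case: (dphi x).
Qed.

Lemma continuous_std_normal_pdf : continuous (normal_pdf 0 1 : R -> R).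
Proof. exact/continuous_normal_pdf/oner_neq0. Qed.

(** The fundamental theorem of calculus on [[-N, N]] leaves the boundary term [2 * F N], as [F] is
    odd. It is kept as a summand beside the integral of [v], so the passage to the limit never
    subtracts possibly infinite integrals. *)
Lemma stein_lebesgue phi phi' : stein_class phi phi' ->
  (\int[mu]_x (x ^+ 2 * phi (x ^+ 2) * normal_pdf 0 1 x)%:E =
   \int[mu]_x ((phi (x ^+ 2) + 2 * x ^+ 2 * phi' (x ^+ 2)) *
               normal_pdf 0 1 x)%:E)%E.
Proof.
move=> Sphi; have [dphi cphi' [A Aphi] phi'0] := Sphi.
have cphi := stein_class_continuous Sphi.
have csq : continuous (fun x : R => x ^+ 2) by move=> x; exact: exprn_continuous.
have cp2 : continuous (fun x : R => phi (x ^+ 2)).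
  by move=> x; apply: continuous_comp; [exact: csq|exact: cphi].
have cp'2 : continuous (fun x : R => phi' (x ^+ 2)).
  by move=> x; apply: continuous_comp; [exact: csq|exact: cphi'].
pose v (x : R) := x ^+ 2 * phi (x ^+ 2) * normal_pdf 0 1 x.
pose u (x : R) := (phi (x ^+ 2) + 2 * x ^+ 2 * phi' (x ^+ 2)) * normal_pdf 0 1 x.
pose F (x : R) := x * phi (x ^+ 2) * normal_pdf 0 1 x.
have cv : continuous v.
  move=> x; apply: cvgM; last exact: continuous_std_normal_pdf.
  by apply: cvgM; [exact: csq|exact: cp2].
have cu : continuous u.
  move=> x; apply: cvgM; last exact: continuous_std_normal_pdf.
  apply: cvgD; first exact: cp2.
  apply: cvgM; last exact: cp'2.
  by apply: cvgM; [exact: cvg_cst|exact: csq].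
have v0 x : 0 <= v x.
  have /andP[h _] := Aphi _ (sqr_ge0 x).
  apply: mulr_ge0; last exact: normal_pdf_ge0.
  by apply: mulr_ge0 => //; exact: sqr_ge0.
have u0 x : 0 <= u x.
  have /andP[h _] := Aphi _ (sqr_ge0 x).
  apply: mulr_ge0; last exact: normal_pdf_ge0.
  apply: addr_ge0 => //; apply: mulr_ge0; last exact/phi'0/sqr_ge0.
  by apply: mulr_ge0 => //; exact: sqr_ge0.
have mv : measurable_fun [set: R] v by exact: continuous_measurable_fun.
have mu' : measurable_fun [set: R] u by exact: continuous_measurable_fun.
have cvgv := cvg_integral_itv_sym mv v0.
have cvgu := cvg_integral_itv_sym mu' u0.
have cF : continuous F.
  move=> x; apply/differentiable_continuous/derivable1_diffP.
  by case: (is_derive_stein x Sphi).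
have eqn n : (\int[mu]_(x in `[(- n.+1%:R)%R, n.+1%:R]) (u x)%:E =
    \int[mu]_(x in `[(- n.+1%:R)%R, n.+1%:R]) (v x)%:E + (2 * F n.+1%:R)%:E)%E.
  set I := `[(- n.+1%:R)%R, n.+1%:R : R].
  have Ic : compact [set` I] by exact: segment_compact.
  have iv : mu.-integrable [set` I] (EFin \o v).
    by apply: continuous_compact_integrable => //; exact: continuous_subspaceT.
  have iu : mu.-integrable [set` I] (EFin \o u).
    by apply: continuous_compact_integrable => //; exact: continuous_subspaceT.
  have : (\int[mu]_(x in [set` I]) (u x - v x)%:E = (F n.+1%:R)%:E - (F (- n.+1%:R))%:E)%E.
    apply: (@continuous_FTC2 _ (u \- v) F).
    - by rewrite (lt_trans (_ : _ < 0)) ?oppr_lt0 ?ltr0n.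
    - apply: continuous_subspaceT => x; apply: cvgB; [exact: cu|exact: cv].
    - split.
      + by move=> x _; case: (is_derive_stein x Sphi).
      + exact: cvg_at_right_filter (cF _).
      + exact: cvg_at_left_filter (cF _).
    - move=> x _; rewrite derive1E.
      have [_ ->] := is_derive_stein x Sphi.
      by rewrite /u /v/=; ring.
  under eq_integral do rewrite EFinB.
  rewrite integralB_EFin//= => h.
  have FN : F (- n.+1%:R) = - F n.+1%:R.
    rewrite /F sqrrN std_normal_pdfE sqrrN; ring.
  move: h; rewrite FN -EFinB opprK => h.
  have fv : (\int[mu]_(x in [set` I]) (v x)%:E)%E \is a fin_num.
    by apply: integrable_fin_num iv.
  rewrite mulr_natl mulr2n -h addeC subeK//.
have bd : (2 * F n.+1%:R)%:E @[n --> \oo] --> (0%:E : \bar R).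
  apply: cvg_EFin; first exact: nearW.
  rewrite -[X in _ --> X](mulr0 2); apply: cvgMr.
  exact: cvg_stein_boundary Sphi.
have defv : (\int[mu]_x (v x)%:E +? 0%:E)%E by rewrite fin_num_adde_defl.
have cvgu' := cvgeD defv cvgv bd.
rewrite adde0 in cvgu'.
rewrite -(funext eqn) in cvgu'.
exact: (cvg_unique (@ereal_hausdorff R) (cvgu' _) cvgu).
Qed.

Lemma measurable_stein_class phi phi' : stein_class phi phi' ->
  measurable_fun [set: R] phi /\ measurable_fun [set: R] phi'.
Proof.
move=> Sphi; split; apply: continuous_measurable_fun; last by case: Sphi.
exact: stein_class_continuous Sphi.
Qed.

Lemma stein_std_normal phi phi' : stein_class phi phi' ->
  (\int[@std_normal R]_x (x ^+ 2 * phi (x ^+ 2))%:E =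
   \int[@std_normal R]_x (phi (x ^+ 2) + 2 * x ^+ 2 * phi' (x ^+ 2))%:E)%E.
Proof.
move=> Sphi; have [dphi cphi' [A Aphi] phi'0] := Sphi.
have [mphi mphi'] := measurable_stein_class Sphi.
have msq : measurable_fun [set: R] (fun x : R => x ^+ 2).
  exact: exprn_measurable.
have m1 : measurable_fun [set: R] (fun x : R => phi (x ^+ 2)).
  exact: (measurableT_comp mphi msq).
have m2 : measurable_fun [set: R] (fun x : R => phi' (x ^+ 2)).
  exact: (measurableT_comp mphi' msq).
rewrite !ge0_integral_std_normal.
- under eq_integral do rewrite -EFinM.
  under [RHS]eq_integral do rewrite -EFinM.
  exact: stein_lebesgue.
- apply/measurable_EFinP; apply: measurable_funD => //.
  by apply: measurable_funM => //; exact: measurable_funM.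
- move=> x; have /andP[h _] := Aphi _ (sqr_ge0 x).
  rewrite lee_fin; apply: addr_ge0 => //; apply: mulr_ge0.
    by apply: mulr_ge0 => //; exact: sqr_ge0.
  exact/phi'0/sqr_ge0.
- by apply/measurable_EFinP; exact: measurable_funM.
- move=> x; have /andP[h _] := Aphi _ (sqr_ge0 x).
  by rewrite lee_fin; apply: mulr_ge0 => //; exact: sqr_ge0.
Qed.

End Stein1b.

(** * Stein's identity for a standard Gaussian vector of any dimension *)

Section GaussianStein.
Context {R : realType}.
Local Open Scope ereal_scope.

Definition sqnorm {k : nat} (z : k.-tuple R) : R := (\sum_(i < k) tnth z i ^+ 2)%R.

Lemma sqnorm_ge0 k (z : k.-tuple R) : (0 <= sqnorm z)%R.
Proof. by apply: sumr_ge0 => i _; exact: sqr_ge0. Qed.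

Lemma sqnorm_cons k (u : R * k.-tuple R) :
  sqnorm (cons_pair u) = (u.1 ^+ 2 + sqnorm u.2)%R.
Proof.
rewrite /sqnorm big_ord_recl tnth0; congr (_ + _)%R.
by apply: eq_bigr => i _; rewrite tnthS.
Qed.

Lemma measurable_sqnorm k : measurable_fun [set: k.-tuple R] (@sqnorm k).
Proof.
apply: measurable_sum => i; apply: measurable_funX; exact: measurable_tnth.
Qed.

Lemma integral_gaussianS k (F : k.+1.-tuple R -> \bar R) :
  measurable_fun setT F -> (forall z, 0 <= F z) ->
  \int[std_gaussian k.+1]_z F z =
  \int[(@std_normal R \x std_gaussian k)]_u F (cons_pair u).
Proof. by move=> mF F0; rewrite /= ge0_integral_distribution. Qed.

Lemma measurable_comp_cons k (F : k.+1.-tuple R -> \bar R) :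
  measurable_fun setT F ->
  measurable_fun setT (fun u : R * k.-tuple R => F (cons_pair u)).
Proof. by move=> mF; apply: measurableT_comp. Qed.

Lemma integral_gaussianS1 k (F : k.+1.-tuple R -> \bar R) :
  measurable_fun setT F -> (forall z, 0 <= F z) ->
  \int[std_gaussian k.+1]_z F z =
  \int[@std_normal R]_x \int[std_gaussian k]_z F (cons_pair (x, z)).
Proof.
move=> mF F0; rewrite integral_gaussianS// fubini_tonelli1//.
exact: measurable_comp_cons.
Qed.

(* Integration by parts for the field [z |-> phi (|z|^2) z]. *)
Lemma stein_gaussian k phi phi' : stein_class phi phi' ->
  \int[std_gaussian k]_z (sqnorm z * phi (sqnorm z))%:E =
  \int[std_gaussian k]_z
    (k%:R * phi (sqnorm z) + 2 * sqnorm z * phi' (sqnorm z))%:E.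
Proof.
elim: k phi phi' => [|k IH] phi phi' Sphi.
  by apply: eq_integral => z _; rewrite /sqnorm big_ord0 mulr0 !mul0r addr0.
have [dphi cphi' [A Aphi] phi'0] := Sphi.
have [mphi mphi'] := measurable_stein_class Sphi.
have phi0 x : (0 <= x -> 0 <= phi x)%R by move=> /Aphi/andP[].
pose a (u : R * k.-tuple R) := (u.1 ^+ 2)%R.
pose b (u : R * k.-tuple R) := sqnorm u.2.
have a0 u : (0 <= a u)%R by exact: sqr_ge0.
have b0 u : (0 <= b u)%R by exact: sqnorm_ge0.
have ab0 u : (0 <= a u + b u)%R by rewrite addr_ge0.
have ma : measurable_fun setT a by apply: measurable_funX; exact: measurable_fst.
have mb : measurable_fun setT b.
  by apply: measurableT_comp measurable_snd; exact: measurable_sqnorm.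
have mab : measurable_fun setT (fun u => a u + b u)%R by exact: measurable_funD.
have mpab : measurable_fun setT (fun u => phi (a u + b u)%R) by exact: (measurableT_comp mphi mab).
have mp'ab : measurable_fun setT (fun u => phi' (a u + b u)%R) by exact: (measurableT_comp mphi' mab).
have mS := @measurable_sqnorm k.+1.
have mpS : measurable_fun setT (fun z : k.+1.-tuple R => phi (sqnorm z)) by exact: (measurableT_comp mphi mS).
have mp'S : measurable_fun setT (fun z : k.+1.-tuple R => phi' (sqnorm z)) by exact: (measurableT_comp mphi' mS).
rewrite !integral_gaussianS; first last.
- by move=> z; rewrite lee_fin mulr_ge0 ?sqnorm_ge0 ?phi0 ?sqnorm_ge0.
- by apply/measurable_EFinP; exact: measurable_funM.
- move=> z; rewrite lee_fin; apply: addr_ge0.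
    by apply: mulr_ge0 => //; exact/phi0/sqnorm_ge0.
  apply: mulr_ge0; last exact/phi'0/sqnorm_ge0.
  by apply: mulr_ge0 => //; exact: sqnorm_ge0.
- apply/measurable_EFinP; apply: measurable_funD; first exact: measurable_funM.
  by apply: measurable_funM => //; exact: measurable_funM.
pose f1 u := (a u * phi (a u + b u))%R.
pose f2 u := (b u * phi (a u + b u))%R.
pose g1 u := (phi (a u + b u) + 2 * a u * phi' (a u + b u))%R.
pose g2 u := (k%:R * phi (a u + b u) + 2 * b u * phi' (a u + b u))%R.
have mf1 : measurable_fun setT f1 by exact: measurable_funM.
have mf2 : measurable_fun setT f2 by exact: measurable_funM.
have mg1 : measurable_fun setT g1.
  apply: measurable_funD => //.
  by apply: measurable_funM => //; exact: measurable_funM.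
have mg2 : measurable_fun setT g2.
  apply: measurable_funD => //; first exact: measurable_funM.
  by apply: measurable_funM => //; exact: measurable_funM.
have f10 u : (0 <= f1 u)%R by rewrite mulr_ge0 ?phi0.
have f20 u : (0 <= f2 u)%R by rewrite mulr_ge0 ?phi0.
have g10 u : (0 <= g1 u)%R.
  apply: addr_ge0; first exact: phi0.
  by apply: mulr_ge0; [exact: mulr_ge0|exact: phi'0].
have g20 u : (0 <= g2 u)%R.
  apply: addr_ge0; first by apply: mulr_ge0 => //; exact: phi0.
  by apply: mulr_ge0; [exact: mulr_ge0|exact: phi'0].
under eq_integral => u _.
  rewrite sqnorm_cons (_ : (_ * _)%:E = (f1 u)%:E + (f2 u)%:E); last first.
    by rewrite -EFinD /f1 /f2/= -mulrDl.
  over.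
under [RHS]eq_integral => u _.
  rewrite sqnorm_cons (_ : (_ + _)%:E = (g1 u)%:E + (g2 u)%:E); last first.
    by rewrite -EFinD /g1 /g2 /a /b/= -natr1; congr EFin; ring.
  over.
rewrite !ge0_integralD//; try exact/measurable_EFinP;
  try by move=> u _; rewrite lee_fin.
congr (_ + _).
- rewrite !fubini_tonelli2//; try exact/measurable_EFinP;
    try by move=> u; rewrite lee_fin.
  apply: eq_integral => z _.
  exact: stein_std_normal (stein_class_shift (sqnorm_ge0 z) Sphi).
- rewrite !fubini_tonelli1//; try exact/measurable_EFinP;
    try by move=> u; rewrite lee_fin.
  apply: eq_integral => x _.
  have := IH _ _ (stein_class_shift (sqr_ge0 x) Sphi).
  under eq_integral do rewrite [X in phi X]addrC.
  under [RHS]eq_integral do rewrite [X in phi X]addrC [X in phi' X]addrC.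
  by [].
Qed.

End GaussianStein.

(** * Chi-square moments and anticoncentration *)

Ltac ge0_side := try first
  [ exact/measurable_EFinP
  | by apply: measurable_funeM; exact/measurable_EFinP
  | by move=> *; rewrite -?EFinM lee_fin ?sqr_ge0 ?sqnorm_ge0
  | by move=> *; rewrite -?EFinM lee_fin; apply: mulr_ge0 => //;
       rewrite ?sqr_ge0 ?sqnorm_ge0 ].

Section ChiSquare.
Context {R : realType}.
Local Open Scope ereal_scope.

Lemma ge0_markov d (T : measurableType d) (m : {measure set T -> \bar R})
    (f : T -> R) (A : set T) (c : R) :
  measurable_fun setT f -> (forall x, 0 <= f x)%R -> measurable A ->
  (0 <= c)%R -> (forall x, A x -> c <= f x)%R ->
  c%:E * m A <= \int[m]_x (f x)%:E.
Proof.
move=> mf f0 mA c0 Af.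
rewrite -[A]setIT -integral_indic// -ge0_integralZl//; last first.
  exact/measurable_EFinP/measurable_indic.
apply: ge0_le_integral => //.
- by move=> x _; rewrite -EFinM lee_fin mulr_ge0.
- apply: measurable_funeM; exact/measurable_EFinP/measurable_indic.
- exact/measurable_EFinP.
- move=> x _; rewrite -EFinM lee_fin indicE.
  by case: (boolP (x \in A)) => [/set_mem/Af|_]; rewrite ?mulr1 ?mulr0.
Qed.

Lemma integral_cst_gaussian k (c : R) : \int[@std_gaussian R k]_z c%:E = c%:E.
Proof.
rewrite integral_cst//= -[RHS]mule1; congr (_ * _).
exact: (probability_setT (@std_gaussian R k)).
Qed.

Lemma stein_class_cst : stein_class (fun=> 1 : R)%R (fun=> 0)%R.
Proof.
split.
- by move=> x; exact: is_derive_cst.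
- by move=> x; exact: cvg_cst.
- by exists 1%R => x x0; rewrite mul1r ler01/= lerDl.
- by [].
Qed.

Lemma stein_class_id : stein_class (fun x => x : R)%R (fun=> 1)%R.
Proof.
split.
- by move=> x; exact: is_derive_id.
- by move=> x; exact: cvg_cst.
- by exists 1%R => x x0; rewrite mul1r x0/= lerDr.
- by [].
Qed.

(** A smooth stand-in for the primitive of the indicator of [[a, a + eta]]: its derivative is at
    least [1 / 2] there. The offset [pi / 2] makes it nonnegative, and it never exceeds
    [eta * pi]. *)
Lemma stein_class_atan (a eta : R) : (0 < eta)%R ->
  stein_class (fun x => eta * (pi / 2 + atan ((x - a) / eta)))%R
              (fun x => (1 + ((x - a) / eta) ^+ 2)^-1)%R.
Proof.
move=> eta0; split.
- move=> x.
  have h : is_derive x 1%R (fun x => (x - a) / eta)%R (eta^-1)%R.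
    rewrite (_ : (fun x : R => _) = eta^-1 \*: (fun x : R => x - a))%R; last first.
      by apply/funext => y /=; rewrite /GRing.scale/= mulrC.
    apply: is_derive_eq; rewrite /GRing.scale/=; ring.
  have h2 := @is_derive1_comp R atan _ x _ _ (is_derive1_atan _) h.
  have h3 := is_deriveZ eta (is_deriveD (is_derive_cst (pi / 2 : R)%R x 1%R) h2).
  apply: (is_derive_eq h3); rewrite /GRing.scale/= add0r.
  have : (1 + ((x - a) / eta) ^+ 2 != 0)%R.
    by rewrite gt_eqF// ltr_pwDl// sqr_ge0.
  by move=> n0; rewrite mulrCA divff ?mulr1// gt_eqF.
- move=> x; apply: cvgV.
    by rewrite gt_eqF// ltr_pwDl// sqr_ge0.
  apply: cvgD; first exact: cvg_cst.
  apply: (@continuous_comp _ _ _ (fun x => (x - a) / eta)%R (fun y => y ^+ 2)%R);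
    last exact: exprn_continuous.
  apply: cvgMl; apply: cvgB; [exact: cvg_id|exact: cvg_cst].
- exists (eta * pi)%R => x x0.
  have := atan_gtNpi2 ((x - a) / eta)%R; have := atan_ltpi2 ((x - a) / eta)%R.
  set t := atan _ => t1 t2; have p0 := pi_ge0 R.
  rewrite mulr_ge0 ?(ltW eta0)//=; last by rewrite -lerBlDl sub0r ltW.
  rewrite -mulrA ler_wpM2l ?(ltW eta0)//; nra.
- by move=> x _; rewrite invr_ge0 addr_ge0 ?sqr_ge0.
Qed.

Section Moments.
Variable k : nat.
Local Notation gam := (@std_gaussian R k).

Let mS := @measurable_sqnorm R k.

Lemma gaussian_sqnorm_mean : \int[gam]_z (sqnorm z)%:E = k%:R%:E.
Proof.
have := stein_gaussian k stein_class_cst.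
under eq_integral do rewrite mulr1.
move=> ->; under eq_integral do rewrite mulr1 mulr0 addr0.
exact: integral_cst_gaussian.
Qed.

Lemma gaussian_sqnorm_sqr :
  \int[gam]_z (sqnorm z ^+ 2)%:E = (k%:R * (k%:R + 2))%:E.
Proof.
have := stein_gaussian k stein_class_id.
under eq_integral do rewrite -expr2.
move=> ->; under eq_integral do rewrite mulr1 -mulrDl EFinM.
rewrite ge0_integralZl//; ge0_side.
by rewrite gaussian_sqnorm_mean -EFinM mulrC.
Qed.

Let mD : measurable_fun setT (fun z : k.-tuple R => (sqnorm z - k%:R) ^+ 2)%R.
Proof. by apply: measurable_funX; exact: measurable_funB. Qed.

Lemma gaussian_sqnorm_var :
  \int[gam]_z ((sqnorm z - k%:R) ^+ 2)%:E = (2 * k%:R)%:E.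
Proof.
(* The square is expanded with nonnegative terms on both sides, so that additivity for nonnegative
   integrands applies; the finite term [2 k k] is cancelled at the end. *)
have E : \int[gam]_z (((sqnorm z - k%:R) ^+ 2)%:E + (2 * k%:R)%:E * (sqnorm z)%:E)
       = \int[gam]_z ((sqnorm z ^+ 2)%:E + (k%:R ^+ 2)%:E).
  apply: eq_integral => z _; rewrite -EFinM -!EFinD; congr EFin; ring.
have mS2 : measurable_fun setT (fun z : k.-tuple R => sqnorm z ^+ 2)%R.
  exact: measurable_funX.
have k0 : (0 <= 2 * k%:R :> R)%R by rewrite mulr_ge0.
rewrite ge0_integralD// in E; ge0_side.
rewrite ge0_integralZl// in E; ge0_side.
rewrite ge0_integralD// in E; ge0_side.
rewrite integral_cst_gaussian in E.
rewrite gaussian_sqnorm_sqr gaussian_sqnorm_mean -EFinM -EFinD in E.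
move: E; case: (integral _ _ _) => [x| |]//= [] E; congr EFin.
by apply: (addIr (2 * k%:R * k%:R)%R); rewrite E; ring.
Qed.

Lemma gaussian_sqnorm_chebyshev (t : R) : (0 < t)%R ->
  gam [set z | (t <= `|sqnorm z - k%:R|)%R] <= (2 * k%:R / t ^+ 2)%:E.
Proof.
move=> t0.
have mA : measurable [set z : k.-tuple R | (t <= `|sqnorm z - k%:R|)%R].
  have -> : [set z : k.-tuple R | (t <= `|sqnorm z - k%:R|)%R] =
      (fun z => `|sqnorm z - k%:R|%R) @^-1` `[t, +oo[%classic.
    by apply/seteqP; split => z /=; rewrite in_itv/= andbT.
  rewrite -[X in measurable X]setTI; apply: (_ : measurable_fun setT _) => //.
  by apply: measurableT_comp => //; exact: measurable_funB.
have := @ge0_markov _ _ gam _ _ (t ^+ 2)%R mD (fun _ => sqr_ge0 _) mA.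
rewrite gaussian_sqnorm_var => /(_ (sqr_ge0 _)) h.
rewrite mulrC EFinM lee_pdivlMl ?exprn_gt0//.
apply: h => z /= tz; rewrite -[((_ - _) ^+ 2)%R]real_normK ?num_real//.
by rewrite lerXn2r ?nnegrE ?(ltW t0).
Qed.

Hypothesis k_gt0 : (0 < k)%N.

(** Integrates the pointwise bound [|t| <= t^2 / (2 s) + s / 2] with [s = sqrt k]: the variance
    [2 k] contributes [s] and the constant [s / 2]. *)
Lemma gaussian_sqnorm_absdev :
  \int[gam]_z (`|sqnorm z - k%:R|)%:E <= (3 / 2 * Num.sqrt k%:R)%:E.
Proof.
set s := Num.sqrt k%:R; have s0 : (0 < s)%R by rewrite sqrtr_gt0 ltr0n.
have sk : (s ^+ 2 = k%:R)%R by rewrite sqr_sqrtr.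
have s1 : (0 <= (2 * s)^-1)%R by rewrite invr_ge0 mulr_ge0// ltW.
have s2 : (0 <= s / 2)%R by rewrite divr_ge0// ltW.
apply: (@le_trans _ _ (\int[gam]_z ((2 * s)^-1%:E * ((sqnorm z - k%:R) ^+ 2)%:E + (s / 2)%:E))).
  apply: ge0_le_integral => //.
  - by apply/measurable_EFinP; apply: measurableT_comp => //; exact: measurable_funB.
  - apply: emeasurable_funD => //; apply: measurable_funeM; exact/measurable_EFinP.
  - move=> z _; rewrite -EFinM -EFinD lee_fin.
    set t := (sqnorm z - _)%R.
    rewrite -[X in (_ * X + _)%R]real_normK ?num_real//; set u := `|t|%R.
    rewrite -(ler_pM2l (_ : 0 < 2 * s)%R); last by rewrite mulr_gt0.
    have -> : (2 * s * ((2 * s)^-1 * u ^+ 2 + s / 2) = u ^+ 2 + s ^+ 2)%R.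
      by field; rewrite gt_eqF.
    have := sqr_ge0 (u - s)%R; nra.
rewrite ge0_integralD//; ge0_side.
rewrite ge0_integralZl//; ge0_side.
rewrite gaussian_sqnorm_var integral_cst_gaussian.
rewrite -EFinM -EFinD lee_fin -sk le_eqVlt; apply/orP; left; apply/eqP.
by field; rewrite gt_eqF.
Qed.

(* Stein's identity for a bounded primitive of a bump on [a, a + eta] bounds
   [a * P(a <= S <= a + eta)] by a multiple of [eta * E|S - k|]. *)
Lemma gaussian_sqnorm_shell (a eta : R) : (0 < a)%R -> (0 < eta)%R ->
  gam [set z | (a <= sqnorm z <= a + eta)%R]
    <= (3 / 2 * pi * eta * Num.sqrt k%:R / a)%:E.
Proof.
move=> a0 eta0.
have mA : measurable [set z : k.-tuple R | (a <= sqnorm z <= a + eta)%R].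
  have -> : [set z : k.-tuple R | (a <= sqnorm z <= a + eta)%R] =
      @sqnorm R k @^-1` `[a, (a + eta)%R]%classic.
    by apply/seteqP; split => z /=; rewrite in_itv.
  by rewrite -[X in measurable X]setTI; exact: mS.
pose phi (x : R) : R := (eta * (pi / 2 + atan ((x - a) / eta)))%R.
pose phi' (x : R) : R := ((1 + ((x - a) / eta) ^+ 2)^-1)%R.
have Sphi : stein_class phi phi' by exact: stein_class_atan.
have [mphi mphi'] := measurable_stein_class Sphi.
have mp : measurable_fun setT (fun z : k.-tuple R => phi (sqnorm z)) by exact: measurableT_comp.
have mp' : measurable_fun setT (fun z : k.-tuple R => phi' (sqnorm z)) by exact: measurableT_comp.
have phib x : (0 <= phi x <= eta * pi)%R.
  have := atan_gtNpi2 ((x - a) / eta)%R; have := atan_ltpi2 ((x - a) / eta)%R.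
  rewrite /phi; set t := atan _ => t1 t2.
  rewrite mulr_ge0 ?(ltW eta0)//=; last by rewrite -lerBlDl sub0r ltW.
  rewrite ler_wpM2l ?(ltW eta0)//; lra.
have phi'0 x : (0 <= phi' x)%R by rewrite invr_ge0 addr_ge0 ?sqr_ge0.
have mdev : measurable_fun setT (fun z : k.-tuple R => `|sqnorm z - k%:R|%R).
  by apply: measurableT_comp => //; exact: measurable_funB.
have m2 : measurable_fun setT (fun z : k.-tuple R => 2 * sqnorm z * phi' (sqnorm z))%R.
  by apply: measurable_funM => //; exact: measurable_funM.
have p2 (z : k.-tuple R) : (0 <= 2 * sqnorm z * phi' (sqnorm z))%R.
  by apply: mulr_ge0 => //; apply: mulr_ge0 => //; exact: sqnorm_ge0.
have m1 : measurable_fun setT (fun z : k.-tuple R => k%:R * phi (sqnorm z))%R.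
  exact: measurable_funM.
have p1 (z : k.-tuple R) : (0 <= k%:R * phi (sqnorm z))%R.
  by apply: mulr_ge0 => //; case/andP: (phib (sqnorm z)).
have ep : (0 <= eta * pi)%R by rewrite mulr_ge0 ?pi_ge0 ?ltW.
(* Formally [E 2 S phi'(S) = E (S - k) phi(S)], which is at most [eta * pi] times [E|S - k|]. To
   avoid a difference of integrals, the finite quantity [k E phi(S)] is added to both sides. *)
have I2 : \int[gam]_z (2 * sqnorm z * phi' (sqnorm z))%:E <=
    (eta * pi)%:E * (3 / 2 * Num.sqrt k%:R)%:E.
  apply: (@le_trans _ _ ((eta * pi)%:E * \int[gam]_z (`|sqnorm z - k%:R|)%:E)); last first.
    apply: lee_wpmul2l; last exact: gaussian_sqnorm_absdev.
    by rewrite lee_fin mulr_ge0 ?pi_ge0 ?ltW.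
  have fin : \int[gam]_z (k%:R * phi (sqnorm z))%:E \is a fin_num.
    rewrite ge0_fin_numE; last by apply: integral_ge0 => z _; rewrite lee_fin.
    apply: (@le_lt_trans _ _ (\int[gam]_z (k%:R * (eta * pi))%:E)).
      apply: ge0_le_integral => //.
      - by move=> z _; rewrite lee_fin.
      - exact/measurable_EFinP.
      - by move=> z _; rewrite lee_fin ler_wpM2l//; case/andP: (phib (sqnorm z)).
    by rewrite integral_cst_gaussian ltry.
  rewrite -(leeD2lE _ _ fin) -ge0_integralD//; ge0_side.
  have := stein_gaussian k Sphi; under [RHS]eq_integral do rewrite EFinD.
  move=> <-.
  rewrite -ge0_integralZl//; ge0_side.
  rewrite -ge0_integralD//; ge0_side.
  apply: ge0_le_integral => //.
  - move=> z _; rewrite lee_fin; apply: mulr_ge0; first exact: sqnorm_ge0.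
    by case/andP: (phib (sqnorm z)).
  - by apply/measurable_EFinP; exact: measurable_funM.
  - apply: emeasurable_funD; first exact/measurable_EFinP.
    by apply: measurable_funeM; exact/measurable_EFinP.
  - move=> z _; rewrite -EFinM -EFinD lee_fin.
    have /andP[h1 h2] := phib (sqnorm z).
    rewrite -lerBlDl -mulrBl [leRHS]mulrC.
    apply: (@le_trans _ _ (`|sqnorm z - k%:R| * phi (sqnorm z))%R).
      by rewrite ler_wpM2r// ler_norm.
    by rewrite ler_wpM2l.
have := @ge0_markov _ _ gam _ _ a m2 p2 mA (ltW a0).
move=> h.
have -> : (3 / 2 * pi * eta * Num.sqrt k%:R / a =
   a^-1 * (eta * pi * (3 / 2 * Num.sqrt k%:R)))%R by ring.
rewrite EFinM lee_pdivlMl//; apply: le_trans I2; apply: h => z /= /andP[az zb].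
have S0 := sqnorm_ge0 z.
set u := ((sqnorm z - a) / eta)%R.
have u1 : (0 <= u <= 1)%R.
  by rewrite divr_ge0 ?subr_ge0 ?(ltW eta0)//= ler_pdivrMr// mul1r lerBlDl.
(* On the shell the bump is at least [1 / 2], so the integrand [2 S phi'(S)] is at least [S], hence
   at least [a]. *)
have : (2^-1 <= phi' (sqnorm z))%R.
  rewrite /phi' -/u lef_pV2 ?posrE ?ltr_pwDl ?sqr_ge0//; nra.
nra.
Qed.

End Moments.
End ChiSquare.

Section Anticoncentration.
Context {R : realType}.
Local Open Scope ereal_scope.

Lemma measurable_sqnorm_le k (c : R) :
  measurable [set z : k.-tuple R | (sqnorm z <= c)%R].
Proof.
have -> : [set z : k.-tuple R | (sqnorm z <= c)%R] =
    @sqnorm R k @^-1` `]-oo, c]%classic.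
  by apply/seteqP; split => z /=; rewrite in_itv.
rewrite -[X in measurable X]setTI; exact: measurable_sqnorm.
Qed.

Lemma std_normal_itv (r : R) : (0 <= r)%R ->
  std_normal `[(- r)%R, r]%classic <= (normal_peak 1 * (2 * r))%:E.
Proof.
move=> r0; rewrite /std_normal /normal_prob.
have q0 : (0 <= normal_peak 1 :> R)%R by exact: normal_peak_ge0.
apply: (@le_trans _ _ (\int[lebesgue_measure]_(x in `[(- r)%R, r]) (normal_peak 1)%:E)).
  apply: ge0_le_integral => //.
  - by move=> x _; rewrite lee_fin normal_pdf_ge0.
  - apply/measurable_EFinP; apply: measurable_funTS; exact: measurable_normal_pdf.
  - by move=> x _; rewrite lee_fin normal_pdf_ub// oner_neq0.
rewrite integral_cst//= lebesgue_measure_itv/= lte_fin.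
case: ifPn => _; last by rewrite mule0 lee_fin !mulr_ge0.
by rewrite -EFinB -EFinM lee_fin; apply: ler_wpM2l => //; lra.
Qed.

(** The ball of radius [r] lies in the slab where the first coordinate is at most [r] in absolute
    value, and the normal density is at most its peak. *)
Lemma gaussian_sqnorm_small k (r : R) : (0 <= r)%R ->
  std_gaussian k.+1 [set z | (sqnorm z <= r ^+ 2)%R]
    <= (normal_peak 1 * (2 * r))%:E.
Proof.
move=> r0; apply: le_trans (std_normal_itv r0).
have mI : measurable (`[(- r)%R, r]%classic `*` [set: k.-tuple R]).
  by apply: measurableX.
have -> : std_normal `[(- r)%R, r]%classic =
    (@std_normal R \x std_gaussian k) (`[(- r)%R, r]%classic `*` setT).
  rewrite product_measure1E//= -[LHS]mule1; congr (_ * _).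
  exact/esym/(probability_setT (@std_gaussian R k)).
rewrite /= /distribution /= /pushforward.
apply: le_measure; rewrite ?inE//.
  rewrite -[X in measurable X]setTI; apply: measurable_cons_pair => //.
  exact: measurable_sqnorm_le.
move=> [x z] /=; rewrite sqnorm_cons/= => h; split => //.
rewrite in_itv/= -ler_norml -(@ler_pXn2r _ 2)// ?nnegrE// real_normK ?num_real//.
by apply: le_trans h; rewrite lerDl sqnorm_ge0.
Qed.

(** The radius is [2 h sqrt k] rather than [h sqrt k] to leave room for a shell of width at most [h]
    that starts below [h sqrt k]. *)
Lemma gaussian_sqnorm_small_unif (e : R) : (0 < e)%R -> exists2 h : R, (0 < h)%R &
  forall k, (0 < k)%N ->
    std_gaussian k [set z | (sqnorm z <= (2 * h) ^+ 2 * k%:R)%R] <= e%:E.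
Proof.
move=> e0; set q : R := normal_peak 1.
have q0 : (0 <= q)%R by exact: normal_peak_ge0.
(* Chebyshev at distance [k / 2] gives [2 k / (k / 2)^2 = 8 / k], which is at most [e] once
   [k >= K]. *)
pose K := (Num.trunc (8 / e)).+1.
have K0 : (0 < K%:R :> R)%R by rewrite ltr0n.
have Ke : (8 / e < K%:R)%R by have /andP[] := trunc_itv (ltW (divr_gt0 (ltr0n R 8) e0)).
(* The first bound gives [(2 h)^2 k <= k / 4], deep in the Chebyshev tail; the second gives
   [4 h K q <= e], which serves all [k < K]. The [+ 1] keeps the denominator positive when only
   [0 <= q] is known. *)
pose h : R := Num.min (1 / 4)%R (e / (4 * K%:R * (q + 1)))%R.
have q1 : (0 < q + 1)%R by lra.
have d0 : (0 < 4 * K%:R * (q + 1))%R by rewrite !mulr_gt0.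
have h0 : (0 < h)%R by rewrite lt_min !divr_gt0.
have h1 : (h <= 1 / 4)%R by rewrite ge_min lexx.
have h2 : (h * (4 * K%:R * (q + 1)) <= e)%R.
  by rewrite -ler_pdivlMr// ge_min lexx orbT.
exists h => // k k0.
have k1 : (1 <= k%:R :> R)%R by rewrite ler1n.
have [Kk|kK] := leqP K k.
- have Kk' : (K%:R <= k%:R :> R)%R by rewrite ler_nat.
  have kp : (0 < k%:R / 2 :> R)%R by lra.
  apply: (@le_trans _ _ (std_gaussian k [set z | (k%:R / 2 <= `|sqnorm z - k%:R|)%R])).
    apply: le_measure; rewrite ?inE; first exact: measurable_sqnorm_le.
      have -> : [set z : k.-tuple R | (k%:R / 2 <= `|sqnorm z - k%:R|)%R] =
          (fun z => `|sqnorm z - k%:R|%R) @^-1` `[(k%:R / 2)%R, +oo[%classic.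
        by apply/seteqP; split => z /=; rewrite in_itv/= andbT.
      rewrite -[X in measurable X]setTI; apply: (_ : measurable_fun setT _) => //.
      apply: measurableT_comp => //; apply: measurable_funB => //.
      exact: measurable_sqnorm.
    move=> z /= Sz; rewrite distrC; apply: (le_trans _ (ler_norm _)).
    have : ((2 * h) ^+ 2 <= 1 / 4)%R by nra.
    move: Sz; set u := ((2 * h) ^+ 2)%R; nra.
  apply: (le_trans (gaussian_sqnorm_chebyshev k kp)); rewrite lee_fin.
  have -> : (2 * k%:R / (k%:R / 2) ^+ 2 = 8 / k%:R :> R)%R by field; lra.
  rewrite ler_pdivrMr; last lra.
  move: Ke; rewrite ltr_pdivrMr//; nra.
- have kK' : (k%:R <= K%:R :> R)%R by rewrite ler_nat ltnW.
  have K1 : (1 <= K%:R :> R)%R by rewrite ler1n.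
  have hK : (0 <= 2 * h * K%:R)%R by rewrite !mulr_ge0// ltW.
  case: k k0 k1 kK kK' => // k _ k1 kK kK'.
  apply: (@le_trans _ _ (std_gaussian k.+1 [set z | (sqnorm z <= (2 * h * K%:R) ^+ 2)%R])).
    apply: le_measure; rewrite ?inE; try exact: measurable_sqnorm_le.
    move=> z /= Sz; apply: (le_trans Sz); rewrite [leRHS]exprMn ler_wpM2l ?sqr_ge0//; nra.
  apply: (le_trans (gaussian_sqnorm_small k hK)); rewrite lee_fin -/q.
  apply: le_trans h2.
  have -> : (q * (2 * (2 * h * K%:R)) = h * (4 * K%:R * q))%R by ring.
  rewrite ler_wpM2l ?(ltW h0)// ler_wpM2l ?mulr_ge0//; lra.
Qed.

(* The shell bound is used when [r >= h sqrt k]; below, the whole ball has small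
   mass, by Chebyshev for large [k] and by the first coordinate for small [k]. *)
Lemma chi_anticoncentration (e : R) : (0 < e)%R -> exists2 delta : R, (0 < delta)%R &
  forall k (r : R), (0 < k)%N ->
    std_gaussian k [set z | (r <= Num.sqrt (sqnorm z) <= r + delta)%R] <= e%:E.
Proof.
move=> e0; have [h h0 small] := gaussian_sqnorm_small_unif e0.
have p0 := pi_gt0 R.
(* With [delta = h tau] and [h s <= r], the width [2 r delta + delta^2] times [s] is at most
   [tau (2 r^2 + r^2)]. The shell bound then becomes [3 / 2 * pi * 3 * tau], whence the constant
   [9 / 2 * pi]. *)
pose tau : R := Num.min 1%R (e / (9 / 2 * pi))%R.
have c0 : (0 < 9 / 2 * pi :> R)%R by rewrite mulr_gt0// divr_gt0.
have t0 : (0 < tau)%R by rewrite lt_min ltr01 divr_gt0.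
have t1 : (tau <= 1)%R by rewrite ge_min lexx.
have t2 : (tau * (9 / 2 * pi) <= e)%R by rewrite -ler_pdivlMr// ge_min lexx orbT.
have ht : (0 < h * tau)%R by rewrite mulr_gt0.
exists (h * tau)%R => // k r k0.
have k1 : (1 <= k%:R :> R)%R by rewrite ler1n.
set s : R := Num.sqrt k%:R.
have sk : (s ^+ 2 = k%:R)%R by rewrite sqr_sqrtr.
have s1 : (1 <= s)%R by rewrite -sqrtr1 ler_sqrt//; lra.
have mA : measurable [set z : k.-tuple R | (r <= Num.sqrt (sqnorm z) <= r + h * tau)%R].
  have -> : [set z : k.-tuple R | (r <= Num.sqrt (sqnorm z) <= r + h * tau)%R] =
      (Num.sqrt \o @sqnorm R k) @^-1` `[r, (r + h * tau)%R]%classic.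
    by apply/seteqP; split => z /=; rewrite in_itv.
  rewrite -[X in measurable X]setTI; apply: (_ : measurable_fun setT _) => //.
  apply: measurableT_comp; last exact: measurable_sqnorm.
  by apply: continuous_measurable_fun; exact: sqrt_continuous.
have hs : (0 < h * s)%R by nra.
have [rs|rs] := lerP (h * s) r.
- have r0 : (0 < r)%R by nra.
  have eta0 : (0 < 2 * r * (h * tau) + (h * tau) ^+ 2)%R.
    by rewrite addr_gt0 ?exprn_gt0// !mulr_gt0.
  apply: (@le_trans _ _ (std_gaussian k
      [set z | (r ^+ 2 <= sqnorm z <= r ^+ 2 + (2 * r * (h * tau) + (h * tau) ^+ 2))%R])).
    apply: le_measure; rewrite ?inE//.
      have -> : [set z : k.-tuple R | (r ^+ 2 <= sqnorm z <= r ^+ 2 + (2 * r * (h * tau) + (h * tau) ^+ 2))%R] =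
          (@sqnorm R k) @^-1` `[(r ^+ 2)%R, (r ^+ 2 + (2 * r * (h * tau) + (h * tau) ^+ 2))%R]%classic.
        by apply/seteqP; split => z /=; rewrite in_itv.
      by rewrite -[X in measurable X]setTI; exact: measurable_sqnorm.
    move=> z /=; set u := Num.sqrt (sqnorm z) => /andP[u1 u2].
    have u0 : (0 <= u)%R by exact: sqrtr_ge0.
    have <- : (u ^+ 2 = sqnorm z)%R by rewrite sqr_sqrtr// sqnorm_ge0.
    have -> : (r ^+ 2 + (2 * r * (h * tau) + (h * tau) ^+ 2) = (r + h * tau) ^+ 2)%R by ring.
    by rewrite !lerXn2r ?nnegrE//; lra.
  have r2 : (0 < r ^+ 2)%R by rewrite exprn_gt0.
  apply: (le_trans (gaussian_sqnorm_shell k0 r2 eta0)); rewrite lee_fin -/s.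
  apply: le_trans t2.
  rewrite ler_pdivrMr//.
  have -> : (3 / 2 * pi * (2 * r * (h * tau) + (h * tau) ^+ 2) * s =
    (3 / 2 * pi * tau) * (2 * r * (h * s) + tau * h * (h * s)))%R by ring.
  have -> : (tau * (9 / 2 * pi) * r ^+ 2 = (3 / 2 * pi * tau) * (3 * r ^+ 2))%R by field.
  rewrite ler_wpM2l//; first by rewrite !mulr_ge0 ?divr_ge0 ?(ltW p0) ?(ltW t0).
  have b1 : (2 * r * (h * s) <= 2 * r ^+ 2)%R by nra.
  have b2 : (tau * h <= h * s)%R by nra.
  have b3 : (tau * h * (h * s) <= r ^+ 2)%R.
    have : (h * s * (h * s) <= r ^+ 2)%R by nra.
    apply: le_trans; exact: ler_wpM2r (ltW hs) _ _ b2.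
  lra.
- apply: le_trans (small k k0); apply: le_measure; rewrite ?inE//.
    exact: measurable_sqnorm_le.
  move=> z /=; set u := Num.sqrt (sqnorm z) => /andP[u1 u2].
  have u0 : (0 <= u)%R by exact: sqrtr_ge0.
  have <- : (u ^+ 2 = sqnorm z)%R by rewrite sqr_sqrtr// sqnorm_ge0.
  rewrite -sk -exprMn lerXn2r ?nnegrE//; first by rewrite !mulr_ge0 ?(ltW h0)//; lra.
  nra.
Qed.

End Anticoncentration.

(** * Rotation invariance and quadratic forms *)

Section Rotation.
Context {R : realType}.
Local Notation mu := (@lebesgue_measure R).
Local Open Scope ereal_scope.

Lemma measurable_prod_lebesgue (K : R * R -> \bar R) :
  measurable_fun [set: R * R] K ->
  measurable_fun [set: measurableTypeR R * measurableTypeR R] K.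
Proof.
move=> mK; have miota : measurable_fun [set: measurableTypeR R] (idfun : _ -> R).
  by move=> _ A mA; rewrite setTI; exact: mA.
have mi : measurable_fun [set: measurableTypeR R * measurableTypeR R]
    (fun u => (u.1 : R, u.2 : R)).
  apply: measurable_fun_pair.
    exact: (measurableT_comp miota measurable_fst).
  exact: (measurableT_comp miota measurable_snd).
rewrite (_ : K = K \o (fun u => (u.1, u.2))); last by apply/funext => -[].
exact: measurableT_comp mK mi.
Qed.

Lemma lebesgue_tonelli (K : R * R -> \bar R) :
  measurable_fun [set: R * R] K -> (forall u, 0 <= K u) ->
  \int[mu]_x \int[mu]_y K (x, y) = \int[mu]_y \int[mu]_x K (x, y).
Proof.
move=> mK K0.
exact: (@fubini_tonelli _ _ _ _ R mu mu K (measurable_prod_lebesgue mK) K0).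
Qed.

Lemma measurable_section1 (K : R * R -> \bar R) (y : R) :
  measurable_fun [set: R * R] K -> measurable_fun [set: R] (fun x => K (x, y)).
Proof.
move=> mK; apply: (measurableT_comp mK); exact: measurable_fun_pair.
Qed.

Lemma measurable_section2 (K : R * R -> \bar R) (x : R) :
  measurable_fun [set: R * R] K -> measurable_fun [set: R] (fun y => K (x, y)).
Proof.
move=> mK; apply: (measurableT_comp mK); exact: measurable_fun_pair.
Qed.

Lemma measurable_shear1 (K : R * R -> \bar R) (t : R) :
  measurable_fun [set: R * R] K ->
  measurable_fun [set: R * R] (fun u => K (u.1 + t * u.2, u.2)%R).
Proof.
move=> mK; apply: (measurableT_comp mK); apply: measurable_fun_pair => //.
by apply: measurable_funD => //; exact: measurable_funM.
Qed.

Lemma measurable_shear2 (K : R * R -> \bar R) (t : R) :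
  measurable_fun [set: R * R] K ->
  measurable_fun [set: R * R] (fun u => K (u.1, u.2 + t * u.1)%R).
Proof.
move=> mK; apply: (measurableT_comp mK); apply: measurable_fun_pair => //.
by apply: measurable_funD => //; exact: measurable_funM.
Qed.

Lemma lebesgue_shear2 (K : R * R -> \bar R) (t : R) :
  measurable_fun [set: R * R] K -> (forall u, 0 <= K u) ->
  \int[mu]_x \int[mu]_y K (x, (y + t * x)%R) = \int[mu]_x \int[mu]_y K (x, y).
Proof.
move=> mK K0; apply: eq_integral => x _.
apply: (@ge0_integral_lebesgue_shift R (fun y => K (x, y))) => //.
exact: measurable_section2.
Qed.

(** Tonelli makes [x] the inner variable, and for fixed [y] the shear is a translation of it. *)
Lemma lebesgue_shear1 (K : R * R -> \bar R) (t : R) :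
  measurable_fun [set: R * R] K -> (forall u, 0 <= K u) ->
  \int[mu]_x \int[mu]_y K ((x + t * y)%R, y) = \int[mu]_x \int[mu]_y K (x, y).
Proof.
move=> mK K0.
have K10 u : 0 <= K (u.1 + t * u.2, u.2)%R by exact: K0.
apply: etrans (lebesgue_tonelli (measurable_shear1 t mK) K10) _.
apply/esym; apply: etrans (lebesgue_tonelli mK K0) _.
apply: eq_integral => y _; apply/esym => /=.
exact: (ge0_integral_lebesgue_shift (t * y)%R (measurable_section1 y mK) (fun x => K0 (x, y))).
Qed.

(* A rotation is a product of three shears, each preserving Lebesgue measure. *)
Lemma lebesgue_rotation (K : R * R -> \bar R) (c s : R) :
  measurable_fun [set: R * R] K -> (forall u, 0 <= K u) ->
  (c ^+ 2 + s ^+ 2 = 1)%R -> (0 <= c)%R ->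
  \int[mu]_x \int[mu]_y K (c * x - s * y, s * x + c * y)%R =
  \int[mu]_x \int[mu]_y K (x, y).
Proof.
move=> mK K0 cs c0.
(* For [c = cos a] and [s = sin a] this is [- tan (a / 2)], the coefficient of the two outer shears;
   [0 <= c] keeps the denominator positive. *)
pose t := (- (s / (1 + c)))%R.
pose K1 u := K (u.1 + t * u.2, u.2)%R.
pose K2 u := K1 (u.1, u.2 + s * u.1)%R.
have mK1 : measurable_fun [set: R * R] K1 by exact: measurable_shear1.
have mK2 : measurable_fun [set: R * R] K2 by exact: measurable_shear2.
have e1 : (s * t = c - 1)%R.
  have : (1 + c != 0)%R by rewrite gt_eqF//; lra.
  move=> n0; rewrite /t; apply: (mulIf n0).
  have -> : (s * - (s / (1 + c)) * (1 + c) = - s ^+ 2)%R by field.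
  have -> : (s ^+ 2 = 1 - c ^+ 2)%R by lra.
  ring.
have e2 : (t + t * c = - s)%R.
  have : (1 + c != 0)%R by rewrite gt_eqF//; lra.
  by move=> n0; rewrite /t; field.
transitivity (\int[mu]_x \int[mu]_y K2 (x + t * y, y)%R).
  apply: eq_integral => x _; apply: eq_integral => y _.
  rewrite /K2 /K1/=.
  have -> : (y + s * (x + t * y) = s * x + c * y)%R.
    have -> : (c = s * t + 1)%R by rewrite e1; ring.
    ring.
  congr (K (_, _)).
  have -> : (x + t * y + t * (s * x + c * y) = (1 + s * t) * x + (t + t * c) * y)%R by ring.
  by rewrite e1 e2; ring.
have K10 u : 0 <= K1 u by exact: K0.
have K20 u : 0 <= K2 u by exact: K0.
apply: etrans (lebesgue_shear1 t mK2 K20) _.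
apply: etrans (lebesgue_shear2 s mK1 K10) _.
exact: lebesgue_shear1.
Qed.

Lemma measurable_int_snd (K : R * R -> \bar R) :
  measurable_fun [set: R * R] K -> (forall u, 0 <= K u) ->
  measurable_fun [set: R] (fun x => \int[@std_normal R]_y K (x, y)).
Proof. by move=> mK K0; exact: (measurable_fun_fubini_tonelli_F _ mK K0). Qed.

(** The product of the two densities depends only on [x^2 + y^2], so it can be absorbed into the
    integrand [K'] before the Lebesgue integral is rotated. *)
Lemma std_normal_rotation (K : R * R -> \bar R) (c s : R) :
  measurable_fun [set: R * R] K -> (forall u, 0 <= K u) ->
  (c ^+ 2 + s ^+ 2 = 1)%R -> (0 <= c)%R ->
  \int[@std_normal R]_x \int[@std_normal R]_y K (c * x - s * y, s * x + c * y)%R =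
  \int[@std_normal R]_x \int[@std_normal R]_y K (x, y).
Proof.
move=> mK K0 cs c0.
pose p := @normal_pdf R 0 1.
have mp : measurable_fun [set: R] p by exact: measurable_normal_pdf.
have p0 x : (0 <= p x)%R by exact: normal_pdf_ge0.
have red (L : R * R -> \bar R) : measurable_fun [set: R * R] L -> (forall u, 0 <= L u) ->
   \int[@std_normal R]_x \int[@std_normal R]_y L (x, y) =
   \int[mu]_x \int[mu]_y (L (x, y) * (p x * p y)%:E).
  move=> mL L0; rewrite ge0_integral_std_normal; first last.
  - by move=> x; apply: integral_ge0 => y _.
  - exact: measurable_int_snd.
  apply: eq_integral => x _; rewrite ge0_integral_std_normal//; last exact: measurable_section2.
  rewrite -ge0_integralZr//.
  - by apply: eq_integral => y _; rewrite -muleA -EFinM mulrC.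
  - apply: emeasurable_funM; first exact: measurable_section2.
    exact/measurable_EFinP.
  - by move=> y _; rewrite mule_ge0// lee_fin.
  - by rewrite lee_fin.
pose L (u : R * R) := K (c * u.1 - s * u.2, s * u.1 + c * u.2)%R.
have mL : measurable_fun [set: R * R] L.
  apply: (measurableT_comp mK); apply: measurable_fun_pair.
    by apply: measurable_funB; exact: measurable_funM.
  by apply: measurable_funD; exact: measurable_funM.
have L0 u : 0 <= L u by exact: K0.
pose K' u := K u * (p u.1 * p u.2)%:E.
have mK' : measurable_fun [set: R * R] K'.
  apply: emeasurable_funM => //; apply/measurable_EFinP; apply: measurable_funM.
    exact: (measurableT_comp mp measurable_fst).
  exact: (measurableT_comp mp measurable_snd).
have K'0 u : 0 <= K' u by rewrite mule_ge0// lee_fin mulr_ge0.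
apply: etrans (red L mL L0) _; apply/esym; apply: etrans (red K mK K0) _.
apply: etrans (esym (lebesgue_rotation mK' K'0 cs c0)) _.
apply: eq_integral => x _; apply: eq_integral => y _.
rewrite /L /K'/=; congr (_ * _%:E).
rewrite /p std_normal_pdfE.
rewrite mulrACA -expRD [RHS]mulrACA -expRD; congr (_ * expR _)%R.
have -> : (- (c * x - s * y) ^+ 2 / 2 + - (s * x + c * y) ^+ 2 / 2 =
   - (c ^+ 2 + s ^+ 2) * (x ^+ 2 + y ^+ 2) / 2)%R by field.
by rewrite cs; field.
Qed.

End Rotation.

(** * Invariance of Gaussian vectors and reduction of projections to coordinates *)

Section GaussianRotation.
Context {R : realType}.

Definition lin_act {m n : nat} (A : 'M[R]_(m, n)) (z : n.-tuple R) : m.-tuple R :=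
  tuple_of_cV (A *m cV_of_tuple z).

Lemma tuple_of_cVK n : cancel (@tuple_of_cV R n) cV_of_tuple.
Proof. by move=> u; apply/colP => i; rewrite mxE tnth_mktuple. Qed.

Lemma cV_of_tupleK n : cancel (@cV_of_tuple R n) tuple_of_cV.
Proof. by move=> z; apply/eq_from_tnth => i; rewrite tnth_mktuple mxE. Qed.

Lemma measurable_lin_act m n (A : 'M[R]_(m, n)) :
  measurable_fun [set: n.-tuple R] (lin_act A).
Proof.
apply/measurable_fun_tnthP => i.
rewrite (_ : _ \o _ = (fun z => \sum_j A i j * tnth z j)); last first.
  apply/funext => z /=; rewrite tnth_mktuple mxE.
  by apply: eq_bigr => j _; rewrite mxE.
apply: measurable_sum => j; apply: measurable_funM => //; exact: measurable_tnth.
Qed.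

Lemma lin_actM m n p (A : 'M[R]_(m, n)) (B : 'M[R]_(n, p)) z :
  lin_act (A *m B) z = lin_act A (lin_act B z).
Proof. by rewrite /lin_act tuple_of_cVK mulmxA. Qed.

Lemma cV_of_tuple_cons n (u : R * n.-tuple R) :
  cV_of_tuple (cons_pair u) = col_mx u.1%:M (cV_of_tuple u.2) :> 'cV[R]_(1 + n).
Proof.
apply/colP => i; rewrite [LHS]mxE; case: (split_ordP i) => j ->.
  rewrite col_mxEu ord1 mxE eqxx mulr1n.
  by rewrite (_ : lshift n 0 = ord0) ?tnth0//; exact: val_inj.
rewrite col_mxEd mxE (_ : rshift 1 j = lift ord0 j); last exact: val_inj.
by rewrite tnthS.
Qed.

Lemma tuple_of_cV_cons n (x : R) (u : 'cV[R]_n) :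
  tuple_of_cV (col_mx x%:M u : 'cV[R]_(1 + n)) = cons_pair (x, tuple_of_cV u).
Proof.
by rewrite -[LHS]cV_of_tupleK -[RHS]cV_of_tupleK tuple_of_cVK cV_of_tuple_cons tuple_of_cVK.
Qed.

Definition gauss_invariant {m : nat} (A : 'M[R]_m) : Prop :=
  forall F : m.-tuple R -> \bar R, measurable_fun setT F ->
    (forall z, (0 <= F z)%E) ->
    (\int[std_gaussian m]_z F (lin_act A z) = \int[std_gaussian m]_z F z)%E.

Lemma gauss_invariantM m (A B : 'M[R]_m) :
  gauss_invariant A -> gauss_invariant B -> gauss_invariant (A *m B).
Proof.
move=> hA hB F mF F0; under eq_integral do rewrite lin_actM.
rewrite (hB (fun z => F (lin_act A z)))//; first exact: hA.
apply: (measurableT_comp mF); exact: measurable_lin_act.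
Qed.

Lemma gauss_invariant1 m : gauss_invariant (1%:M : 'M[R]_m).
Proof.
move=> F mF F0; apply: eq_integral => z _.
by rewrite /lin_act mul1mx cV_of_tupleK.
Qed.

Lemma gauss_invariant_block m (A : 'M[R]_m) : gauss_invariant A ->
  gauss_invariant (block_mx 1%:M 0 0 A : 'M[R]_(1 + m)).
Proof.
move=> hA F mF F0.
have mact : measurable_fun setT
    (fun z => F (lin_act (block_mx 1%:M 0 0 A : 'M[R]_(1 + m)) z)).
  by apply: (measurableT_comp mF); exact: measurable_lin_act.
apply: etrans (integral_gaussianS1 mact (fun z => F0 _)) _; apply/esym.
apply: etrans (integral_gaussianS1 mF F0) _.
apply: eq_integral => x _.
rewrite -(hA (fun z => F (cons_pair (x, z))))//.
- apply: eq_integral => z _; apply/esym.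
  rewrite /lin_act cV_of_tuple_cons mul_block_col !mul0mx mul1mx addr0 add0r.
  by rewrite tuple_of_cV_cons.
- apply: (measurableT_comp mF); apply: (measurableT_comp measurable_cons_pair).
  exact: measurable_fun_pair.
Qed.

(** The rotation of the first two coordinates that fixes the others, nested as [1 + (1 + m)] so that
    its blocks match two uses of [cons_pair]. *)
Definition givens (m : nat) (c s : R) : 'M[R]_(1 + (1 + m)) :=
  block_mx c%:M (row_mx (- s)%:M (0 : 'rV_m)) (col_mx s%:M (0 : 'cV_m)) (block_mx c%:M 0 0 1%:M).

Lemma givens_orth m c s : c ^+ 2 + s ^+ 2 = 1 ->
  givens m c s *m (givens m c s)^T = 1%:M.
Proof.
move=> cs; rewrite /givens tr_block_mx tr_row_mx tr_col_mx tr_block_mx.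
rewrite !tr_scalar_mx !trmx0 mulmx_block.
rewrite !mul_row_col !(mul_row_block, mul_block_col, mul_col_mx, mul_mx_row,
  mulmx_block, mul_col_row).
rewrite -!scalar_mxM !(mul0mx, mulmx0, mul1mx, add_col_mx, add_row_mx, addr0, add0r).
rewrite -!raddfD/=.
have -> : c * c + - s * - s = 1 by rewrite -cs; ring.
have -> : s * s + c * c = 1 by rewrite -cs; ring.
have -> : c * s + - s * c = 0 by ring.
have -> : s * c + c * - s = 0 by ring.
rewrite !raddf0 row_mx0 col_mx0 -/(block_mx _ _ _ _).
by rewrite mulr1 -!scalar_mx_block.
Qed.

Lemma gauss_invariant_givens m c s : c ^+ 2 + s ^+ 2 = 1 -> 0 <= c ->
  gauss_invariant (givens m c s).
Proof.
move=> cs c0 F mF F0.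
have mact : measurable_fun setT (fun z => F (lin_act (givens m c s) z)).
  by apply: (measurableT_comp mF); exact: measurable_lin_act.
(* The fixed coordinates are integrated out, which leaves a function of the plane to be rotated. *)
pose K (u : R * R) := (\int[std_gaussian m]_z F (cons_pair (u.1, cons_pair (u.2, z))))%E.
have mcons2 x : measurable_fun setT (fun z : (1 + m).-tuple R => cons_pair (x, z)).
  by apply: (measurableT_comp measurable_cons_pair); exact: measurable_fun_pair.
have K0 u : (0 <= K u)%E by exact: integral_ge0.
have mK : measurable_fun [set: R * R] K.
  apply: (@measurable_fun_fubini_tonelli_F _ _ _ _ R (std_gaussian m)
    (fun u : (R * R) * m.-tuple R => F (cons_pair (u.1.1, cons_pair (u.1.2, u.2))))) => //.
  apply: (measurableT_comp mF); apply: (measurableT_comp measurable_cons_pair).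
  apply: measurable_fun_pair.
    exact: (measurableT_comp measurable_fst measurable_fst).
  apply: (measurableT_comp measurable_cons_pair).
  apply: measurable_fun_pair => //.
  exact: (measurableT_comp measurable_snd measurable_fst).
have red (H : (1 + (1 + m)).-tuple R -> \bar R) : measurable_fun setT H ->
   (forall z, (0 <= H z)%E) ->
   (\int[std_gaussian (1 + (1 + m))]_z H z =
    \int[@std_normal R]_x \int[@std_normal R]_y \int[std_gaussian m]_z
      H (cons_pair (x, cons_pair (y, z))))%E.
  move=> mH H0; rewrite integral_gaussianS1//.
  apply: eq_integral => x _; rewrite integral_gaussianS1//.
  exact: (measurableT_comp mH (mcons2 x)).
apply: etrans (red _ mact (fun z => F0 _)) _; apply/esym.
apply: etrans (red _ mF F0) _.
apply: etrans (esym (std_normal_rotation mK K0 cs c0)) _; apply/esym.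
apply: eq_integral => x _; apply: eq_integral => y _; apply: eq_integral => z _.
rewrite /lin_act /givens cV_of_tuple_cons cV_of_tuple_cons/=.
rewrite mul_block_col mul_row_col mul_col_mx mul_block_col !mul0mx mul1mx.
rewrite !addr0 add0r add_col_mx add0r -!scalar_mxM -!raddfD/=.
rewrite tuple_of_cV_cons tuple_of_cV_cons cV_of_tupleK.
by congr (F (cons_pair (_, _))); rewrite mulNr.
Qed.

(* Givens elimination: the last nonzero entry is repeatedly rotated away. *)
Lemma gauss_invariant_row m (v : 'rV[R]_(1 + m)) :
  exists A : 'M[R]_(1 + m), exists c : R,
    [/\ gauss_invariant A, A *m A^T = 1%:M & v *m A = row_mx c%:M 0].
Proof.
elim: m v => [|m IH] v.
  exists 1%:M, (v 0 0); split; [exact: gauss_invariant1|by rewrite trmx1 mulmx1|].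
  rewrite mulmx1 -[LHS]hsubmxK [lsubmx v]mx11_scalar; congr row_mx.
    by rewrite mxE; congr (v _ _)%:M; exact: val_inj.
  by apply/matrixP => i [].
rewrite -[m.+1]/(1 + m)%N in v *.
have [A [b [iA oA vA]]] := IH (rsubmx v).
pose a := lsubmx v 0 0.
pose r := Num.sqrt (a ^+ 2 + b ^+ 2).
have r2 : r ^+ 2 = a ^+ 2 + b ^+ 2 by rewrite sqr_sqrtr// addr_ge0 ?sqr_ge0.
(* The condition [b * c = a * s] cancels the second entry of [(a, b)]. The decomposition into shears
   needs [0 <= c], so both signs are flipped when [a < 0]; when [a = b = 0] the identity does. *)
have [c [s [cs c0 e]]] : exists c s, [/\ c ^+ 2 + s ^+ 2 = 1, 0 <= c & b * c = a * s].
  have [r0|r0] := eqVneq r 0.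
    exists 1, 0; rewrite expr1n expr0n addr0 ler01; split => //.
    move: r2; rewrite r0 expr0n/= => /esym/eqP.
    rewrite paddr_eq0 ?sqr_ge0// !sqrf_eq0 => /andP[/eqP -> /eqP ->].
    by rewrite !mul0r.
  have r1 : 0 <= r by exact: sqrtr_ge0.
  have [a0|a0] := lerP 0 a.
    exists (a / r), (b / r); split; last ring.
    - rewrite !expr_div_n -mulrDl -r2 divff// expf_neq0//.
    - exact: divr_ge0.
  exists (- a / r), (- b / r); split; last ring.
  - by rewrite !expr_div_n !sqrrN -mulrDl -r2 divff// expf_neq0.
  - by rewrite divr_ge0// oppr_ge0 ltW.
exists ((block_mx 1%:M 0 0 A : 'M[R]_(1 + (1 + m))) *m givens m c s), (a * c + b * s); split.
- by apply: gauss_invariantM; [exact: gauss_invariant_block|exact: gauss_invariant_givens].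
- rewrite trmx_mul !mulmxA -[X in X *m _]mulmxA givens_orth// mulmx1.
  rewrite tr_block_mx !trmx0 trmx1 mulmx_block !mul0mx !mulmx0 mulmx1 oA.
  by rewrite !addr0 !add0r -scalar_mx_block.
- rewrite -[v]hsubmxK mulmxA mul_row_block !mulmx0 mulmx1 addr0 add0r vA.
  rewrite [lsubmx v]mx11_scalar -/a /givens mul_row_block mul_row_col.
  rewrite !(mul_mx_row, mul_row_block, mulmx0, mul0mx, mulmx1, add_row_mx, addr0, add0r).
  rewrite -!scalar_mxM -!raddfD/=.
  have -> : a * - s + b * c = 0 by rewrite e; ring.
  by rewrite raddf0 row_mx0.
Qed.

Definition quad_form {m : nat} (Q : 'M[R]_m) (z : m.-tuple R) : R :=
  ((cV_of_tuple z)^T *m Q *m cV_of_tuple z) 0 0.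

Lemma measurable_quad_form m (Q : 'M[R]_m) : measurable_fun setT (quad_form Q).
Proof.
rewrite (_ : quad_form Q =
  (fun z => \sum_i (\sum_j tnth z j * Q j i) * tnth z i)); last first.
  apply/funext => z; rewrite /quad_form mxE; apply: eq_bigr => i _.
  rewrite !mxE; congr (_ * _); apply: eq_bigr => j _; by rewrite !mxE.
apply: measurable_sum => i; apply: measurable_funM; last exact: measurable_tnth.
apply: measurable_sum => j; apply: measurable_funM => //; exact: measurable_tnth.
Qed.

Lemma quad_form_act m n (A : 'M[R]_(m, n)) (Q : 'M[R]_m) z :
  quad_form Q (lin_act A z) = quad_form (A^T *m Q *m A) z.
Proof. by rewrite /quad_form /lin_act tuple_of_cVK trmx_mul !mulmxA. Qed.

(** Induction on the dimension in place of a diagonalization: a nonzero row of the projection is a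
    fixed vector, and an orthogonal invariant matrix takes it to the first axis. The projection then
    splits as 1 and a projection [D] of rank one less. The statement is for all [f] because the
    induction hypothesis is applied to [f] shifted by the square of the first coordinate. *)
Lemma gaussian_quad_form m (Q : 'M[R]_m) (f : R -> \bar R) :
  Q *m Q = Q -> Q^T = Q -> measurable_fun setT f -> (forall x, (0 <= f x)%E) ->
  (\int[std_gaussian m]_z f (quad_form Q z) =
   \int[std_gaussian (\rank Q)]_z f (sqnorm z))%E.
Proof.
elim: m Q f => [|m IH] Q f QQ QT mf f0; last first.
  have [Q0|Q0] := eqVneq Q 0; last first.
    have [i vi] : exists i, row i Q != 0.
      apply/existsP; rewrite -negb_forall; apply: contra Q0 => /forallP h.
      by apply/eqP/row_matrixP => i; rewrite row0; exact/eqP.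
    pose v : 'rV[R]_(1 + m) := row i Q.
    have vQ : v *m Q = v by rewrite /v -row_mul QQ.
    have [A [c [iA oA vA]]] := gauss_invariant_row v.
    have oA' : A^T *m A = 1%:M by apply: mulmx1C.
    have c0 : c != 0.
      apply: contra vi => /eqP c0; apply/eqP.
      by rewrite -/v -[v]mulmx1 -oA mulmxA vA c0 raddf0 row_mx0 mul0mx.
    pose Q' : 'M[R]_(1 + m) := A^T *m Q *m A.
    have Q'Q' : Q' *m Q' = Q'.
      by rewrite /Q' !mulmxA -[X in X *m Q]mulmxA oA mulmx1 -[X in X *m A]mulmxA QQ.
    have Q'T : Q'^T = Q' by rewrite /Q' !trmx_mul trmxK QT mulmxA.
    have rQ' : \rank Q' = \rank Q.
      have uA : A \in unitmx by case/mulmx1_unit: oA.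
      by rewrite /Q' mxrankMfree ?row_free_unit// eqmxMfull// row_full_unit unitmx_tr.
    have eQ' : row_mx c%:M 0 *m Q' = row_mx c%:M 0.
      by rewrite -vA /Q' !mulmxA -[v *m A *m _]mulmxA oA mulmx1 vQ.
    pose D : 'M[R]_m := drsubmx Q'.
    have Q'E : Q' = block_mx 1%:M 0 0 D.
      have := eQ'; rewrite -[Q']submxK mul_row_block !mul0mx !addr0 !mul_scalar_mx.
      move=> /eq_row_mx[e1 e2].
      have ul : ulsubmx Q' = 1%:M.
        apply: (scalerI c0); rewrite e1 -[c%:M]scalemx1//.
      have ur : ursubmx Q' = 0 by apply: (scalerI c0); rewrite e2 scaler0.
      have dl : dlsubmx Q' = 0 by rewrite -[Q']Q'T -trmx_ursub ur trmx0.
      by rewrite ul ur dl.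
    have := Q'Q'; rewrite Q'E mulmx_block !mul0mx !mulmx0 mulmx1 !addr0 !add0r.
    move=> /eq_block_mx[_ _ _ DD].
    have := Q'T; rewrite Q'E tr_block_mx !trmx0 => /eq_block_mx[_ _ _ DT].
    have rD : \rank Q = (\rank D).+1.
      by rewrite -rQ' Q'E rank_diag_block_mx mxrank1.
    have mq (P : 'M[R]_(1 + m)) : measurable_fun setT (fun z => f (quad_form P z)).
      by apply: (measurableT_comp mf); exact: measurable_quad_form.
    have mS k : measurable_fun setT (fun z : k.-tuple R => f (sqnorm z)).
      by apply: (measurableT_comp mf); exact: measurable_sqnorm.
    rewrite rD; apply/esym; apply: etrans (integral_gaussianS1 (mS _) (fun z => f0 _)) _.
    apply/esym; apply: etrans (esym (iA _ (mq Q) (fun z => f0 _))) _.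
    under eq_integral do rewrite quad_form_act.
    apply: etrans (integral_gaussianS1 (mq Q') (fun z => f0 _)) _.
    apply: eq_integral => x _.
    under eq_integral => z _.
      rewrite -/Q' Q'E /quad_form cV_of_tuple_cons tr_col_mx mul_row_block.
      rewrite !mulmx0 addr0 add0r mul_row_col mulmx1 tr_scalar_mx -scalar_mxM.
      rewrite mxE [X in X + _]mxE eqxx mulr1n/=.
      rewrite -/(quad_form D z).
      over.
    under [RHS]eq_integral do rewrite sqnorm_cons/=.
    apply: (IH D (fun y => f (x * x + y))) => //.
    by apply: (measurableT_comp mf); exact: measurable_funD.
  subst Q; rewrite mxrank0; under eq_integral do rewrite /quad_form mulmx0 mul0mx mxE.
  under [RHS]eq_integral do rewrite /sqnorm big_ord0.
  rewrite !integral_cst//; congr (_ * _)%E.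
  by transitivity (1%E : \bar R); [|symmetry]; exact: probability_setT.
have -> : \rank Q = 0%N by apply/eqP; rewrite -leqn0 rank_leq_row.
apply: eq_integral => z _; congr f.
by rewrite /quad_form mxE /sqnorm !big_ord0.
Qed.

End GaussianRotation.

(** * Algebra of the regression model *)

Section Norm2.
Context {R : realType}.

Lemma norm2_ge0 m (u : 'cV[R]_m) : 0 <= norm2 u. Proof. exact: sqrtr_ge0. Qed.

Lemma sqr_norm2 m (u : 'cV[R]_m) : norm2 u ^+ 2 = \sum_(i < m) u i 0 ^+ 2.
Proof. by rewrite sqr_sqrtr// sumr_ge0// => i _; exact: sqr_ge0. Qed.

Lemma norm20 m : norm2 (0 : 'cV[R]_m) = 0.
Proof.
apply/eqP; rewrite -sqrf_eq0 sqr_norm2 big1// => i _; by rewrite mxE expr0n.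
Qed.

Lemma norm2_eq0 m (u : 'cV[R]_m) : norm2 u = 0 -> u = 0.
Proof.
move=> u0; have : \sum_(i < m) u i 0 ^+ 2 = 0 by rewrite -sqr_norm2 u0 expr0n.
move=> /eqP; rewrite psumr_eq0 => [/allP h|i _]; last exact: sqr_ge0.
apply/colP => i; rewrite mxE; apply/eqP; rewrite -sqrf_eq0.
by have := h i (mem_index_enum _).
Qed.

Lemma norm2Z m (a : R) (u : 'cV[R]_m) : norm2 (a *: u) = `|a| * norm2 u.
Proof.
apply/eqP; rewrite -(@eqrXn2 _ 2)//; last 2 first.
- exact: norm2_ge0.
- by rewrite mulr_ge0// norm2_ge0.
rewrite exprMn !sqr_norm2 real_normK ?num_real// mulr_sumr; apply/eqP.
by apply: eq_bigr => i _; rewrite mxE exprMn.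
Qed.

(** With [A], [B], [C] the three sums, the nonnegative sum of [(a_i B - b_i C)^2] equals
    [B (A B - C^2)]; divide by [B]. *)
Lemma sum_Cauchy_Schwarz (I : finType) (a b : I -> R) :
  (\sum_i a i * b i) ^+ 2 <= (\sum_i a i ^+ 2) * (\sum_i b i ^+ 2).
Proof.
set A := \sum_i a i ^+ 2; set B := \sum_i b i ^+ 2; set C := \sum_i a i * b i.
have B0 : 0 <= B by apply: sumr_ge0 => i _; exact: sqr_ge0.
have [Bz|Bnz] := eqVneq B 0.
  have b0 i : b i = 0.
    move: Bz => /eqP; rewrite psumr_eq0 => [/allP h|j _]; last exact: sqr_ge0.
    by apply/eqP; rewrite -sqrf_eq0; exact: h (mem_index_enum _).
  by rewrite Bz mulr0 /C big1 ?expr0n// => i _; rewrite b0 mulr0.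
have : 0 <= \sum_i (a i * B - b i * C) ^+ 2.
  by apply: sumr_ge0 => i _; exact: sqr_ge0.
have -> : \sum_i (a i * B - b i * C) ^+ 2 = B * (A * B - C ^+ 2).
  transitivity (\sum_i (B ^+ 2 * a i ^+ 2 - 2 * B * C * (a i * b i) + C ^+ 2 * b i ^+ 2)).
    by apply: eq_bigr => i _; ring.
  by rewrite big_split/= sumrB -!mulr_sumr -/A -/B -/C; ring.
by rewrite pmulr_rge0 ?subr_ge0// lt_def Bnz.
Qed.

Lemma norm2D m (u v : 'cV[R]_m) : norm2 (u + v) <= norm2 u + norm2 v.
Proof.
rewrite -(@ler_pXn2r _ 2)// ?nnegrE ?addr_ge0 ?norm2_ge0//.
have -> : norm2 (u + v) ^+ 2 =
    norm2 u ^+ 2 + 2 * (\sum_i u i 0 * v i 0) + norm2 v ^+ 2.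
  rewrite !sqr_norm2 mulr_sumr -!big_split/=; apply: eq_bigr => i _.
  by rewrite mxE; ring.
have CS := sum_Cauchy_Schwarz (fun i => u i 0) (fun i => v i 0).
rewrite -!sqr_norm2 -exprMn in CS.
have : \sum_i u i 0 * v i 0 <= norm2 u * norm2 v.
  apply: (le_trans (ler_norm _)).
  rewrite -(@ler_pXn2r _ 2)// ?nnegrE ?mulr_ge0 ?norm2_ge0//.
  by rewrite real_normK ?num_real.
nra.
Qed.

Lemma norm2N m (u : 'cV[R]_m) : norm2 (- u) = norm2 u.
Proof. by rewrite -scaleN1r norm2Z normrN1 mul1r. Qed.

Lemma norm2_dist m (u v : 'cV[R]_m) : `|norm2 u - norm2 v| <= norm2 (u - v).
Proof.
rewrite ler_norml; apply/andP; split.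
  have := norm2D u (v - u); rewrite addrC subrK -[v - u]opprB norm2N; lra.
have := norm2D v (u - v); rewrite addrC subrK; lra.
Qed.

Lemma norm2_sum (I : finType) (P : pred I) m (F : I -> 'cV[R]_m) :
  norm2 (\sum_(i | P i) F i) <= \sum_(i | P i) norm2 (F i).
Proof.
elim/big_ind2 : _ => [|x1 x2 y1 y2 h1 h2|//]; first by rewrite norm20.
by apply: (le_trans (norm2D _ _)); exact: lerD.
Qed.

(** The Frobenius bound shows that the set whose supremum is [spectral_norm] is bounded above, so
    that the supremum is indeed an upper bound. *)
Lemma norm2_mulmx_ub m n (A : 'M[R]_(m, n)) (u : 'cV[R]_n) :
  norm2 (A *m u) <= Num.sqrt (\sum_i \sum_j A i j ^+ 2) * norm2 u.
Proof.
have A0 : 0 <= \sum_i \sum_j A i j ^+ 2.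
  by apply: sumr_ge0 => i _; apply: sumr_ge0 => j _; exact: sqr_ge0.
rewrite -(@ler_pXn2r _ 2)// ?nnegrE ?mulr_ge0 ?norm2_ge0 ?sqrtr_ge0//.
rewrite exprMn !sqr_norm2 sqr_sqrtr// mulr_suml; apply: ler_sum => i _.
by rewrite mxE; exact: (sum_Cauchy_Schwarz (fun j => A i j) (fun j => u j 0)).
Qed.

Lemma spectral_normP m n (A : 'M[R]_(m, n)) (u : 'cV[R]_n) :
  norm2 (A *m u) <= spectral_norm A * norm2 u.
Proof.
have [u0|u0] := eqVneq (norm2 u) 0.
  by rewrite (norm2_eq0 u0) mulmx0 !norm20 mulr0.
have up : 0 < norm2 u by rewrite lt_def u0 norm2_ge0.
rewrite -ler_pdivrMr//.
pose v := (norm2 u)^-1 *: u.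
have v1 : norm2 v <= 1.
  by rewrite norm2Z ger0_norm ?invr_ge0 ?norm2_ge0// mulVf.
have -> : norm2 (A *m u) / norm2 u = norm2 (A *m v).
  rewrite -scalemxAr norm2Z ger0_norm ?invr_ge0 ?norm2_ge0// mulrC//.
apply: ub_le_sup; last by exists v.
exists (Num.sqrt (\sum_i \sum_j A i j ^+ 2)) => _ [w /= w1 <-].
apply: (le_trans (norm2_mulmx_ub A w)).
by rewrite ler_piMr ?sqrtr_ge0.
Qed.

Lemma mulmx_tr_eq0 m n (A : 'M[R]_(m, n)) : A *m A^T = 0 -> A = 0.
Proof.
move=> AA; apply/matrixP => i j; rewrite mxE.
have := congr1 (fun B : 'M[R]_m => B i i) AA; rewrite !mxE.
under eq_bigr do rewrite mxE -expr2.
move=> /eqP; rewrite psumr_eq0 => [/allP h|k _]; last exact: sqr_ge0.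
by apply/eqP; rewrite -sqrf_eq0; exact: h (mem_index_enum _).
Qed.

End Norm2.

Section ModelAlgebra.
Context {R : realType} {n p M : nat}.
Variables (X : 'M[R]_(n, p)) (Gr : 'I_M -> {set 'I_p}) (G : {set 'I_p}).
Hypothesis HGr : is_grouping Gr.

Lemma group_fitE (A : {set 'I_p}) (u : 'cV[R]_p) :
  group_fit X A u = \sum_(i in A) u i 0 *: col i X.
Proof.
rewrite big_enum_val/=; apply/colP => j; rewrite !mxE summxE.
by apply: eq_bigr => a _; rewrite !mxE mulrC.
Qed.

Lemma group_fit_split (A : {set 'I_p}) (u : 'cV[R]_p) :
  group_fit X A u = group_fit X (A :&: G) u + group_fit X (A :\: G) u.
Proof. by rewrite !group_fitE -big_setID. Qed.

Lemma sum_group_fit (u : 'cV[R]_p) : \sum_(k < M) group_fit X (Gr k) u = X *m u.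
Proof.
have [injG /and3P[/eqP cov triv _]] := HGr.
have -> : X *m u = \sum_(i in [set: 'I_p]%SET) u i 0 *: col i X.
  apply/colP => j; rewrite !mxE summxE; apply: eq_big => [i|i _]; first by rewrite finset.in_setT.
  by rewrite !mxE mulrC.
rewrite -cov finset.big_trivIset//=.
rewrite finset.big_imset/=; last by move=> i j _ _; exact: injG.
by apply: eq_big => [i|i _]; rewrite ?group_fitE// inE.
Qed.

Lemma proj_colK m q (A : 'M[R]_(m, q)) : proj_col A *m A = A.
Proof. by rewrite /proj_col; case: (mp_invP A). Qed.

Lemma Qproj_fit (A : {set 'I_p}) u : Qproj X A *m group_fit X A u = group_fit X A u.
Proof. by rewrite /Qproj /group_fit mulmxA proj_colK. Qed.

(** A group inside [G] leaves no column to project on, so sums over all groups reduce to the groups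
    not contained in [G]. *)
Lemma Qproj_sub (A : {set 'I_p}) : A \subset G -> Qproj X (A :\: G) = 0.
Proof.
move=> AG; have A0 : #|(A :\: G)%SET| = 0%N.
  by apply/eqP; rewrite cards_eq0 finset.setD_eq0.
rewrite /Qproj /proj_col (_ : subcols _ _ = 0) ?mul0mx//.
by apply/matrixP => i [j jA]; exfalso; rewrite A0 in jA.
Qed.

Lemma Xtilde_fit (u : 'cV[R]_p) : Xtilde X Gr G *m subvec G u =
  \sum_(k < M) (1%:M - Qproj X (Gr k :\: G)) *m group_fit X (Gr k) u.
Proof.
rewrite XtildeE; apply: eq_bigr => k _.
rewrite group_fit_split mulmxDr [X in _ = _ + X]mulmxBl mul1mx Qproj_fit subrr addr0.
by rewrite -mulmxA.
Qed.

Lemma corrected_responseE (beta binit : 'cV[R]_p) (eps : 'cV[R]_n) :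
  corrected_response X Gr G (X *m beta + eps) binit
    - Xtilde X Gr G *m subvec G beta =
  eps + \sum_(k < M | ~~ (Gr k \subset G)) Qproj X (Gr k :\: G) *m
    (group_fit X (Gr k) beta - group_fit X (Gr k) binit).
Proof.
have -> : X *m beta = Xtilde X Gr G *m subvec G beta +
    \sum_(k < M | ~~ (Gr k \subset G)) Qproj X (Gr k :\: G) *m group_fit X (Gr k) beta.
  rewrite [X in _ + X](_ : _ = \sum_k Qproj X (Gr k :\: G) *m group_fit X (Gr k) beta).
    rewrite Xtilde_fit -big_split/= -sum_group_fit; apply: eq_bigr => k _.
    by rewrite mulmxBl mul1mx subrK.
  rewrite [RHS](bigID (fun k => ~~ (Gr k \subset G)))/= [X in _ = _ + X]big1 ?addr0//.
  by move=> k /negbNE kG; rewrite Qproj_sub ?mul0mx.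
rewrite /corrected_response.
under [X in _ = _ + X]eq_bigr do rewrite mulmxBr.
rewrite sumrB; set a := Xtilde _ _ _ *m _; set b := \sum_(k < M | _) _.
set c := \sum_(k < M | _) _.
move: a b c => a b c; apply/colP => i; rewrite !mxE; ring.
Qed.

Variable (P : 'M[R]_n).
Hypotheses (PP : P *m P = P) (PT : P^T = P).

(** A vector in the range of [P] that [Qtilde] kills is fixed by [P *m (1%:M - Qtilde X Gr G)],
    hence zero when the spectral norm is below 1. So [Qtilde] is injective on the range of [P], and
    its own rank is at most [#|G|]. *)
Lemma rank_proj_le :
  spectral_norm (P *m (1%:M - Qtilde X Gr G)) < 1 -> (\rank P <= #|G|)%N.
Proof.
move=> sn1; set Q := Qtilde X Gr G.
have QT : Q^T = Q by exact: proj_col_tr.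
have rQ : (\rank Q <= #|G|)%N.
  by rewrite (leq_trans (mxrankM_maxl _ _))// rank_leq_col.
apply: leq_trans rQ.
have cap0 : (P :&: kermx Q = 0)%MS.
  apply/eqP; rewrite -submx0; apply/row_subP => i.
  set u := row i _.
  have uP : (u <= P)%MS by rewrite (submx_trans (row_sub _ _))// capmxSl.
  have uQ : u *m Q = 0.
    by apply/sub_kermxP; rewrite (submx_trans (row_sub _ _))// capmxSr.
  have uPu : u *m P = u by case/submxP: uP => D ->; rewrite -mulmxA PP.
  have e1 : P *m u^T = u^T by rewrite -{1}PT -trmx_mul uPu.
  have e2 : Q *m u^T = 0 by rewrite -QT -trmx_mul uQ trmx0.
  have := spectral_normP (P *m (1%:M - Q)) u^T.
  rewrite -mulmxA mulmxBl mul1mx e2 subr0 e1 => h.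
  have u0 : norm2 u^T = 0.
    apply/eqP; rewrite eq_le norm2_ge0 andbT; have := norm2_ge0 u^T; nra.
  by have := norm2_eq0 u0; rewrite submx0 => /(congr1 trmx); rewrite trmxK trmx0 => ->.
have := mxrank_mul_ker P Q; rewrite cap0 mxrank0 addn0 => <-.
exact: mxrankM_maxr.
Qed.

Section FullRank.
Hypothesis rankP : (\rank P <= #|G|)%N.
Hypothesis full : \rank (P *m Xtilde X Gr G) = #|G|.

(** The columns of [P *m Xtilde X Gr G] lie in the range of [P], whose dimension is at most [#|G|];
    full rank forces the two spaces to coincide. *)
Lemma proj_col_full : proj_col (P *m Xtilde X Gr G) *m P = P.
Proof.
set A := P *m Xtilde X Gr G.
have sAP : (A^T <= P)%MS by rewrite trmx_mul PT submxMl.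
have sPA : (P <= A^T)%MS.
  by have := mxrank_leqif_sup sAP => -[_ <-]; rewrite mxrank_tr full eqn_leq rankP
     -{1}full -mxrank_tr mxrankS.
case/submxP: sPA => D PE.
have -> : P = A *m D^T by rewrite -PT PE trmx_mul trmxK.
by rewrite mulmxA proj_colK.
Qed.

(** The least squares fit leaves no residual: it reproduces the whole projected response, which
    removes the pseudo-inverse from the analysis. *)
Lemma betahatE (y : 'cV[R]_n) (binit beta : 'cV[R]_p) :
  P *m Xtilde X Gr G *m (betahat X Gr G P y binit - subvec G beta) =
  P *m (corrected_response X Gr G y binit - Xtilde X Gr G *m subvec G beta).
Proof.
rewrite mulmxBr [RHS]mulmxBr -[_ *m Xtilde _ _ _ *m subvec _ _]mulmxA; congr (_ - _).
by rewrite /betahat [LHS]mulmxA -/(proj_col _) [LHS]mulmxA proj_col_full.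
Qed.

End FullRank.

Lemma Qtilde_Xtilde q (u v : 'M[R]_(#|G|, q)) :
  P *m Qtilde X Gr G *m (Xtilde X Gr G *m u - Xtilde X Gr G *m v) =
  P *m Xtilde X Gr G *m (u - v).
Proof. by rewrite -mulmxBr mulmxA -[P *m _ *m Xtilde _ _ _]mulmxA proj_colK. Qed.

End ModelAlgebra.

(** * Random vectors *)

Section MeasurableVectors.
Context {R : realType} {d : measure_display} {T : measurableType d}.

Definition measurable_cV {m} (f : T -> 'cV[R]_m) : Prop :=
  forall i, measurable_fun [set: T] (fun w => f w i 0).

Lemma measurable_cVP m (f : T -> 'cV[R]_m) :
  measurable_fun [set: T] (fun w => tuple_of_cV (f w)) <-> measurable_cV f.
Proof.
split=> [/measurable_fun_tnthP h i|h].
  have := h i; rewrite (_ : _ \o _ = (fun w => f w i 0))//.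
  by apply/funext => w /=; rewrite tnth_mktuple.
apply/measurable_fun_tnthP => i; rewrite (_ : _ \o _ = (fun w => f w i 0))//.
by apply/funext => w /=; rewrite tnth_mktuple.
Qed.

Lemma measurable_cV_cst m (u : 'cV[R]_m) : measurable_cV (fun=> u).
Proof. by move=> i; exact: measurable_cst. Qed.

Lemma measurable_cVD m (f g : T -> 'cV[R]_m) :
  measurable_cV f -> measurable_cV g -> measurable_cV (fun w => f w + g w).
Proof.
move=> mf mg i; under eq_fun do rewrite mxE; exact: measurable_funD.
Qed.

Lemma measurable_cVB m (f g : T -> 'cV[R]_m) :
  measurable_cV f -> measurable_cV g -> measurable_cV (fun w => f w - g w).
Proof.
move=> mf mg i; under eq_fun do rewrite !mxE; exact: measurable_funB.
Qed.

Lemma measurable_cVZ m (a : T -> R) (f : T -> 'cV[R]_m) :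
  measurable_fun [set: T] a -> measurable_cV f -> measurable_cV (fun w => a w *: f w).
Proof.
move=> ma mf i; under eq_fun do rewrite mxE; exact: measurable_funM.
Qed.

Lemma measurable_cVM m q (A : 'M[R]_(m, q)) (f : T -> 'cV[R]_q) :
  measurable_cV f -> measurable_cV (fun w => A *m f w).
Proof.
move=> mf i; under eq_fun do rewrite mxE.
by apply: measurable_sum => j; exact: measurable_funM.
Qed.

Lemma measurable_cV_sum (I : finType) (Q : pred I) m (F : I -> T -> 'cV[R]_m) :
  (forall i, measurable_cV (F i)) -> measurable_cV (fun w => \sum_(i | Q i) F i w).
Proof.
move=> mF j; under eq_fun do rewrite summxE.
under eq_fun do rewrite big_mkcond/=.
apply: measurable_sum => i; case: (Q i) => //; exact: mF.
Qed.

Lemma measurable_norm2 m (f : T -> 'cV[R]_m) :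
  measurable_cV f -> measurable_fun [set: T] (fun w => norm2 (f w)).
Proof.
move=> mf; have ms : measurable_fun [set: R] (@Num.sqrt R).
  by apply: continuous_measurable_fun; exact: sqrt_continuous.
apply: (measurableT_comp ms).
by apply: measurable_sum => i; apply: measurable_funX; exact: mf.
Qed.

Lemma measurable_group_fit n p (X : 'M[R]_(n, p)) (A : {set 'I_p}) (f : T -> 'cV[R]_p) :
  measurable_cV f -> measurable_cV (fun w => group_fit X A (f w)).
Proof.
move=> mf; apply: measurable_cVM => i; under eq_fun do rewrite mxE; exact: mf.
Qed.

Lemma measurable_fun_le (f g : T -> R) :
  measurable_fun [set: T] f -> measurable_fun [set: T] g ->
  measurable [set w | f w <= g w].
Proof.
move=> /measurable_EFinP mf /measurable_EFinP mg.
by have := measurable_lee measurableT mf mg; rewrite setTI.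
Qed.

End MeasurableVectors.

Lemma integral_indic_comp {R : realType} d (T : measurableType d)
    (m : {measure set T -> \bar R}) (f : T -> R) (B : set R) :
  measurable_fun setT f -> measurable B ->
  (\int[m]_z (\1_B (f z))%:E = m [set z | B (f z)])%E.
Proof.
move=> mf mB; have mfB : measurable (f @^-1` B).
  by rewrite -[X in measurable X]setTI; exact: mf.
transitivity (\int[m]_z (\1_(f @^-1` B) z)%:E)%E.
  apply: eq_integral => z _; rewrite !indicE.
  suff -> : (f z \in B) = (z \in f @^-1` B) by [].
  by apply/idP/idP => /set_mem h; exact/mem_set.
by rewrite integral_indic// setIT.
Qed.

Lemma sqr_norm2_tr {R : realType} n (v : 'cV[R]_n) : norm2 v ^+ 2 = (v^T *m v) 0 0.
Proof. by rewrite sqr_norm2 mxE; apply: eq_bigr => i _; rewrite mxE expr2. Qed.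

(** The inverse is 0 at 0, so the line is cut at that point and continuity is used elsewhere. This
    makes the studentized vectors measurable even where [sigmahat] vanishes. *)
Lemma measurable_inv {R : realType} : measurable_fun [set: R] (fun x : R => x^-1).
Proof.
have m0 : measurable [set 0 : R] by exact: measurable_set1.
have mC : measurable (~` [set 0 : R]) by exact: measurableC.
rewrite -(setUv [set 0 : R]); apply/measurable_funU => //; split.
  apply: (eq_measurable_fun (cst (0 : R))); last exact: measurable_cst.
  by move=> x /set_mem ->; rewrite invr0.
apply: open_continuous_measurable_fun; first exact/closed_openC/closed_eq.
by move=> x /set_mem /= x0; apply: inv_continuous; exact/eqP.
Qed.

Section GaussianVectors.
Context {R : realType} {d : measure_display} {T : measurableType d}
  (Pr : probability T R).

Lemma gaussian_lin n q (xi : T -> 'cV[R]_n) (S : 'M[R]_n) (B : 'M[R]_(q, n)) :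
  is_gaussian Pr xi S -> is_gaussian Pr (fun w => B *m xi w) (B *m S *m B^T).
Proof.
move=> [mxi [m [A [AS law]]]]; split.
  by apply/measurable_cVP; apply: measurable_cVM; apply/measurable_cVP.
exists m, (B *m A); split; first by rewrite trmx_mul -AS !mulmxA.
move=> E mE; have mE' : measurable (lin_act B @^-1` E).
  by rewrite -[X in measurable X]setTI; exact: measurable_lin_act.
have := law _ mE'; rewrite /lin_act.
rewrite (_ : [set w | _] = [set w | E (tuple_of_cV (B *m xi w))]); last first.
  by apply/seteqP; split => w /=; rewrite tuple_of_cVK.
move=> ->; congr (std_gaussian m _).
by apply/seteqP; split => w /=; rewrite tuple_of_cVK mulmxA.
Qed.

(** Writing [xi] in law as [A z] with [A A^T = P], the squared norm is the quadratic form of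
    [A^T A]. This is again a projection, on a space of possibly different dimension, and has the
    rank of [P]. *)
Lemma gaussian_proj_norm2 n (xi : T -> 'cV[R]_n) (P : 'M[R]_n) (B : set R) :
  P *m P = P -> P^T = P -> is_gaussian Pr xi P -> measurable B ->
  Pr [set w | B (norm2 (xi w) ^+ 2)] =
  std_gaussian (\rank P) [set z | B (sqnorm z)].
Proof.
move=> PP PT [mxi [m [A [AP law]]]] mB.
have norm2E (u : 'cV[R]_n) : norm2 u ^+ 2 = sqnorm (tuple_of_cV u).
  by rewrite sqr_norm2 /sqnorm; apply: eq_bigr => i _; rewrite tnth_mktuple.
have mB' : measurable (@sqnorm R n @^-1` B).
  by rewrite -[X in measurable X]setTI; exact: measurable_sqnorm.
under eq_set do rewrite norm2E.
rewrite (law _ mB') {law}.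
pose Q := A^T *m A.
(* The product of [P A - A] with its transpose is zero. *)
have PA : P *m A = A.
  apply/eqP; rewrite -subr_eq0; apply/eqP/mulmx_tr_eq0.
  rewrite linearB/= trmx_mul PT mulmxBl !mulmxBr !mulmxA.
  by rewrite -![_ *m A *m A^T]mulmxA AP !PP !subrr.
have QQ : Q *m Q = Q by rewrite /Q !mulmxA -[_ *m A *m _]mulmxA AP -mulmxA PA.
have QT : Q^T = Q by rewrite /Q trmx_mul trmxK.
have rQ : \rank Q = \rank P.
  apply/eqP; rewrite eqn_leq; apply/andP; split.
    rewrite -QQ /Q !mulmxA -[_ *m A *m _]mulmxA AP.
    by rewrite (leq_trans (mxrankM_maxl _ _))// mxrankM_maxr.
  rewrite -{1}PP -AP !mulmxA -[A *m A^T *m A]mulmxA.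
  by rewrite (leq_trans (mxrankM_maxl _ _))// mxrankM_maxr.
have mind : measurable_fun [set: R] (fun x => (\1_B x)%:E : \bar R).
  exact/measurable_EFinP/measurable_indic.
have := gaussian_quad_form QQ QT mind (fun x => _).
move=> /(_ ltac:(by move=> x; rewrite lee_fin)) => h.
rewrite !integral_indic_comp// in h; try exact: measurable_sqnorm; try exact: measurable_quad_form.
rewrite -rQ -h; congr (std_gaussian m _).
have e z : sqnorm (tuple_of_cV (A *m cV_of_tuple z)) = quad_form Q z.
  by rewrite -norm2E sqr_norm2_tr /quad_form /Q trmx_mul !mulmxA.
by apply/seteqP; split => z /=; rewrite e.
Qed.

End GaussianVectors.

(** * Comparison of distribution functions of nearby variables *)

Section Sandwich.
Context {R : realType} {d : measure_display} {T : measurableType d}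
  (Pr : probability T R).

Lemma probabilityU_le (A B : set T) : measurable A -> measurable B ->
  (Pr (A `|` B) <= Pr A + Pr B)%E.
Proof. by move=> mA mB; exact: measureU2. Qed.

Lemma probability_diff_le (E F C : set T) (x : R) :
  measurable E -> measurable F -> measurable C -> E `<=` F `|` C -> F `<=` E `|` C ->
  (Pr C <= x%:E)%E -> (`|Pr E - Pr F| <= x%:E)%E.
Proof.
move=> mE mF mC EF FE Cx.
have h (A B : set T) : measurable A -> measurable B -> A `<=` B `|` C ->
    (Pr A <= Pr B + x%:E)%E.
  move=> mA mB AB; apply: (@le_trans _ _ (Pr (B `|` C))).
    by apply: le_measure; rewrite ?inE//; exact: measurableU.
  by apply: (le_trans (probabilityU_le _ _)) => //; exact: leeD2l.
have := h _ _ mE mF EF; have := h _ _ mF mE FE.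
have : Pr E \is a fin_num by exact: fin_num_measure.
have : Pr F \is a fin_num by exact: fin_num_measure.
case: (Pr E) => [a| |]//; case: (Pr F) => [b| |]// _ _.
rewrite -!EFinD !lee_fin => h1 h2.
by rewrite /= ?lee_fin ler_norml; apply/andP; split; lra.
Qed.

(** Off [B] the two events disagree only if [Z] is within [delta] of [sqrt t], above it for one
    inclusion and below it for the other. Each inequality pays for a single shell, so [e2] is
    counted once. *)
Lemma sandwich_le (Z W : T -> R) (E B : set T) (t delta e1 e2 : R) :
  measurable_fun setT Z -> measurable E -> measurable B ->
  (forall w, 0 <= Z w) -> (forall w, 0 <= W w) ->
  (forall w, ~ B w -> (E w <-> W w ^+ 2 <= t)) ->
  (forall w, ~ B w -> `|W w - Z w| <= delta) ->
  (Pr B <= e1%:E)%E ->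
  (forall r, Pr [set w | (r <= Z w <= r + delta)%R] <= e2%:E)%E ->
  (`|Pr E - Pr [set w | Z w ^+ 2 <= t]%R| <= (e1 + e2)%:E)%E.
Proof.
move=> mZ mE mB Z0 W0 EW WZ PB shell.
have mF : measurable [set w | Z w ^+ 2 <= t].
  by apply: measurable_fun_le => //; exact: measurable_funX.
have mSh r : measurable [set w | r <= Z w <= r + delta].
  rewrite (_ : [set w | _] = [set w | r <= Z w] `&` [set w | Z w <= r + delta]).
    by apply: measurableI; exact: measurable_fun_le.
  by apply/seteqP; split => w /= => [/andP|] [] h1 h2 => //; apply/andP.
have sq0 (x : R) : 0 <= x -> 0 <= t -> (x ^+ 2 <= t) = (x <= Num.sqrt t).
  by move=> x0 t0; rewrite -{1}(sqr_sqrtr t0) ler_pXn2r ?nnegrE ?sqrtr_ge0.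
(* For [t < 0] both events are empty off [B], and [0 <= e2] follows from any one shell bound. *)
have [t0|t0] := leP 0 t; last first.
  have F0 : [set w | Z w ^+ 2 <= t] = set0.
    apply/seteqP; split => w //= h; have := sqr_ge0 (Z w); lra.
  apply: (@probability_diff_le _ _ B) => //.
  - move=> w Ew; right; apply: contrapT => nB.
    by have /(EW _ nB) := Ew; have := sqr_ge0 (W w); lra.
  - by rewrite F0.
  - apply: (le_trans PB); rewrite lee_fin lerDl -lee_fin.
    exact: le_trans (measure_ge0 _ _) (shell 0).
set q := Num.sqrt t.
pose S1 := [set w | q <= Z w <= q + delta].
pose S2 := [set w | q - delta <= Z w <= q - delta + delta].
have half C S : measurable S -> (Pr S <= e2%:E)%E -> C = B `|` S ->
   (Pr C <= (e1 + e2)%:E)%E.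
  move=> mS PS ->; rewrite EFinD; apply: (le_trans (probabilityU_le _ _)) => //.
  exact: leeD.
have hE : (Pr E <= Pr [set w | Z w ^+ 2 <= t]%R + (e1 + e2)%:E)%E.
  apply: (@le_trans _ _ (Pr ([set w | Z w ^+ 2 <= t] `|` (B `|` S1)))).
    apply: le_measure; rewrite ?inE//.
      by apply: measurableU => //; apply: measurableU => //; exact: mSh.
    move=> w Ew; have [Bw|nB] := pselect (B w); first by right; left.
    have /(EW _ nB) := Ew; rewrite sq0// -/q => Wq.
    have := WZ _ nB; rewrite ler_norml => /andP[h1 h2].
    have [Zq|Zq] := leP (Z w) q; first by left => /=; rewrite sq0.
    by right; right; rewrite /S1/=; apply/andP; split; lra.
  apply: (le_trans (probabilityU_le _ _)) => //.
    by apply: measurableU => //; exact: mSh.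
  by apply: leeD2l; apply: (half _ S1) => //; [exact: mSh|exact: shell].
have hF : (Pr [set w | Z w ^+ 2 <= t]%R <= Pr E + (e1 + e2)%:E)%E.
  apply: (@le_trans _ _ (Pr (E `|` (B `|` S2)))).
    apply: le_measure; rewrite ?inE//.
      by apply: measurableU => //; apply: measurableU => //; exact: mSh.
    move=> w /=; rewrite sq0// -/q => Zq.
    have [Bw|nB] := pselect (B w); first by right; left.
    have := WZ _ nB; rewrite ler_norml => /andP[h1 h2].
    have [Wq|Wq] := leP (W w) q; first by left; apply/(EW _ nB); rewrite sq0.
    by right; right; rewrite /S2/=; apply/andP; split; lra.
  apply: (le_trans (probabilityU_le _ _)) => //.
    by apply: measurableU => //; exact: mSh.
  by apply: leeD2l; apply: (half _ S2) => //; [exact: mSh|exact: shell].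
have : Pr E \is a fin_num by exact: fin_num_measure.
have : Pr [set w | Z w ^+ 2 <= t]%R \is a fin_num by exact: fin_num_measure.
move: hE hF; case: (Pr E) => [a| |]//; case: (Pr _) => [b| |]//.
rewrite -!EFinD !lee_fin => h1 h2 _ _.
by rewrite /= ?lee_fin ler_norml; apply/andP; split; lra.
Qed.

End Sandwich.

(** * Deterministic error bounds at a fixed sample size *)

Section OneModel.
Context {R : realType} {n p M : nat}.
Variables (X : 'M[R]_(n, p)) (Gr : 'I_M -> {set 'I_p}) (G : {set 'I_p}).
Variables (omega' : 'I_M -> R) (P : 'M[R]_n).
Hypotheses (n_gt0 : (0 < n)%N) (HGr : is_grouping Gr).
Hypothesis HP : feasible X Gr G omega' P.

Let snr : R := Num.sqrt n%:R.

(** The blocks of a partition are nonempty, so the first square root is already positive. *)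
Lemma omega_star_gt0 j : 0 < omega_star n Gr j :> R.
Proof.
rewrite /omega_star ltr_pwDl ?sqrtr_ge0// sqrtr_gt0 divr_gt0 ?ltr0n//.
have [_ /and3P[_ _ G0]] := HGr.
rewrite card_gt0; apply: contra G0 => /eqP <-.
by apply: finset.imset_f.
Qed.

(** Each term is multiplied and divided by its weight: the largest ratio comes out, and the weighted
    sum that the estimation bound controls is left. *)
Lemma remainder_bound (delta : 'I_M -> 'cV[R]_n) :
  norm2 (P *m \sum_(k < M | ~~ (Gr k \subset G)) Qproj X (Gr k :\: G) *m delta k)
  <= \big[Num.max/0]_(k < M | ~~ (Gr k \subset G)) (omega' k / omega_star n Gr k) *
     \sum_(k < M) omega_star n Gr k * norm2 (delta k).
Proof.
have [_ _ Pom] := HP.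
set mx := \big[Num.max/0]_(k < M | _) _.
have mxk k : ~~ (Gr k \subset G) -> omega' k <= mx * omega_star n Gr k.
  move=> kG; rewrite -ler_pdivrMr ?omega_star_gt0//.
  exact: (@le_bigmax_cond _ _ _ 0 k (fun k => ~~ (Gr k \subset G))
    (fun k => omega' k / omega_star n Gr k)).
have mx0 : 0 <= mx by exact: bigmax_ge_id.
rewrite mulmx_sumr; apply: (le_trans (norm2_sum _ _)).
apply: (@le_trans _ _ (\sum_(k < M | ~~ (Gr k \subset G))
    mx * (omega_star n Gr k * norm2 (delta k)))).
  apply: ler_sum => k kG; rewrite mulmxA; apply: (le_trans (spectral_normP _ _)).
  rewrite mulrA ler_wpM2r ?norm2_ge0//.
  exact: le_trans (Pom k) (mxk k kG).
rewrite -mulr_sumr ler_wpM2l// [leRHS](bigID (fun k => ~~ (Gr k \subset G)))/= lerDl.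
by apply: sumr_ge0 => k _; rewrite mulr_ge0 ?norm2_ge0 ?ltW ?omega_star_gt0.
Qed.

(** With [q = sigma / sigmahat], the difference is [(q - 1)] times the Gaussian part plus
    [q / sigma] times the remainder. The ratios [u] of [sigmahat] to the oracle scale and [v] of
    that scale to [sigma] are within [c] of 1. As [c <= 1 / 4], their product is at least [1 / 2]
    and within [3 c] of 1; hence [q <= 2] and [|q - 1| <= 6 c]. *)
Lemma studentized_bound (eps : 'cV[R]_n) (beta binit : 'cV[R]_p)
    (sigma sigmahat h c L : R) :
  0 < sigma -> h <= c -> c <= 1 / 4 ->
  `|sigmahat / (norm2 eps / snr) - 1| + snr^-1 *
     \sum_(j < M) omega_star n Gr j / sigma *
       norm2 (group_fit X (Gr j) binit - group_fit X (Gr j) beta) <= h ->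
  `|norm2 (sigma^-1 *: eps) ^+ 2 - n%:R| <= n%:R * c ->
  norm2 (sigma^-1 *: (P *m eps)) <= L ->
  sigmahat != 0 /\
  norm2 (sigmahat^-1 *: (P *m (corrected_response X Gr G (X *m beta + eps) binit
           - Xtilde X Gr G *m subvec G beta)) - sigma^-1 *: (P *m eps))
  <= 6 * c * L +
     2 * (snr * h * \big[Num.max/0]_(k < M | ~~ (Gr k \subset G))
       (omega' k / omega_star n Gr k)).
Proof.
move=> s0 hc c4 Hest Heps HL; set mx := \big[Num.max/0]_(k < M | _) _.
have mx0 : 0 <= mx by exact: bigmax_ge_id.
have n0 : 0 < n%:R :> R by rewrite ltr0n.
have snr0 : 0 < snr by rewrite sqrtr_gt0.
have snr2 : snr ^+ 2 = n%:R by rewrite sqr_sqrtr// ltW.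
set S := \sum_(j < M) _ in Hest.
have S0 : 0 <= S.
  by apply: sumr_ge0 => j _; rewrite mulr_ge0 ?norm2_ge0// divr_ge0 ?ltW// omega_star_gt0.
have iS0 : 0 <= snr^-1 * S by rewrite mulr_ge0// invr_ge0 ltW.
have Hu : `|sigmahat / (norm2 eps / snr) - 1| <= h by lra.
have HS : S <= snr * h.
  have : snr^-1 * S <= h by have := normr_ge0 (sigmahat / (norm2 eps / snr) - 1); lra.
  by rewrite mulrC ler_pdivrMr// mulrC.
have c0 : 0 <= c by have := normr_ge0 (sigmahat / (norm2 eps / snr) - 1); lra.
have L0 : 0 <= L by apply: le_trans HL; exact: norm2_ge0.
set sst := norm2 eps / snr in Hu *.
pose v := sst / sigma.
have v0 : 0 <= v by rewrite /v /sst !divr_ge0 ?norm2_ge0// ltW.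
have v2 : n%:R * v ^+ 2 = norm2 (sigma^-1 *: eps) ^+ 2.
  rewrite norm2Z ger0_norm ?invr_ge0 ?ltW// /v /sst !exprMn !exprVn snr2.
  by field; rewrite !gt_eqF.
have hv : `|v ^+ 2 - 1| <= c.
  have : `|n%:R * (v ^+ 2 - 1)| <= n%:R * c by rewrite mulrBr v2 mulr1.
  by rewrite normrM (gtr0_norm n0) ler_pM2l.
have /andP[v1 v1'] : - c <= v - 1 <= c.
  move: hv; rewrite ler_norml => /andP[h1 h2]; apply/andP; split; nra.
have sst0 : sst != 0.
  by apply: contraTneq v1 => z; rewrite /v z mul0r; lra.
pose u := sigmahat / sst.
have /andP[u1 u2] : - c <= u - 1 <= c by rewrite -ler_norml (le_trans Hu).
have uv : u * v = sigmahat / sigma by rewrite /u /v; field; rewrite sst0 gt_eqF.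
have uv2 : 1 / 2 <= u * v by nra.
have sh0 : sigmahat != 0.
  by apply: contraTneq uv2 => z; rewrite uv z mul0r -ltNge; lra.
split=> //.
pose q := sigma / sigmahat.
have quv : q * (u * v) = 1 by rewrite uv /q; field; rewrite sh0 gt_eqF.
have q0 : 0 < q by nra.
have q2 : q <= 2 by nra.
have b1 : - (3 * c) <= u * v - 1 by nra.
have b2 : u * v - 1 <= 3 * c by nra.
have hq : `|q - 1| <= 6 * c.
  have -> : q - 1 = q * (1 - u * v) by rewrite mulrBr quv mulr1.
  rewrite normrM (gtr0_norm q0).
  apply: (@le_trans _ _ (2 * `|1 - u * v|)); first exact: ler_wpM2r.
  suff : `|1 - u * v| <= 3 * c by lra.
  by rewrite ler_norml; apply/andP; split; lra.
rewrite corrected_responseE// mulmxDr.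
set Rem := P *m \sum_(k < M | _) _.
have HRem : norm2 Rem <= mx * (sigma * S).
  apply: (le_trans (remainder_bound _)); rewrite ler_wpM2l// /S mulr_sumr.
  apply: ler_sum => k _; rewrite -[X in norm2 X]opprB norm2N.
  rewrite le_eqVlt; apply/orP; left; apply/eqP; field; rewrite gt_eqF//.
have -> : sigmahat^-1 *: (P *m eps + Rem) - sigma^-1 *: (P *m eps) =
    (q - 1) *: (sigma^-1 *: (P *m eps)) + (q * sigma^-1) *: Rem.
  rewrite scalerBl scale1r scalerA scalerDr.
  have -> : q * sigma^-1 = sigmahat^-1 by rewrite /q; field; rewrite sh0 gt_eqF.
  by rewrite -!addrA [RHS]addrCA [in RHS]addrC -addrA; congr (_ + _); rewrite addrC.
apply: (le_trans (norm2D _ _)); apply: lerD.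
  by rewrite norm2Z ler_pM// norm2_ge0.
have qs0 : 0 <= q * sigma^-1 by rewrite mulr_ge0 ?invr_ge0 ?(ltW q0) ?(ltW s0).
rewrite norm2Z (ger0_norm qs0).
have : sigma^-1 * norm2 Rem <= mx * S.
  rewrite mulrC ler_pdivrMr//; apply: (le_trans HRem).
  by rewrite mulrCA mulrC.
have : mx * S <= mx * (snr * h) by rewrite ler_wpM2l.
move=> k1 k2.
have k3 : 0 <= sigma^-1 * norm2 Rem by rewrite mulr_ge0 ?norm2_ge0// invr_ge0 ltW.
apply: (@le_trans _ _ (2 * (sigma^-1 * norm2 Rem))).
  by rewrite -[leLHS]mulrA ler_wpM2r.
by rewrite ler_wpM2l// (le_trans k2)// (le_trans k1)// mulrC.
Qed.

End OneModel.

(** * Limits *)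

Section Limits.
Context {R : realType}.

Lemma cvg_ereal0 (I : Type) (F : set_system I) {FF : Filter F} (f : I -> \bar R) :
  (forall e : R, 0 < e -> \forall n \near F, (0 <= f n <= e%:E)%E) -> f @ F --> 0%E.
Proof.
move=> h A [e /= e0 eA]; rewrite /nbhs/=.
have e20 : 0 < e / 2 by rewrite divr_gt0.
near=> n; suff : A (f n) by [].
have /andP[] : (0 <= f n <= (e / 2)%:E)%E by near: n; exact: h.
case: (f n) => [r| |]//; rewrite !lee_fin => r0 re; apply: eA => /=.
by rewrite sub0r normrN ger0_norm//; lra.
Unshelve. all: by end_near. Qed.

Lemma measurable_cV_corrected d (T : measurableType d) n p M
    (X : 'M[R]_(n, p)) (Gr : 'I_M -> {set 'I_p}) (G : {set 'I_p})
    (y : T -> 'cV[R]_n) (b : T -> 'cV[R]_p) :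
  measurable_cV y -> measurable_cV b ->
  measurable_cV (fun w => corrected_response X Gr G (y w) (b w)).
Proof.
move=> my mb; apply: measurable_cVB => //.
by apply: measurable_cV_sum => k; apply/measurable_cVM/measurable_group_fit.
Qed.

Lemma gaussian_sqnorm_tail k (c : R) : 0 < c ->
  (std_gaussian k [set z | (c <= sqnorm z)%R] <= (k%:R / c)%:E)%E.
Proof.
move=> c0; rewrite mulrC EFinM lee_pdivlMl//.
rewrite -(gaussian_sqnorm_mean k).
apply: ge0_markov => //; [exact: measurable_sqnorm|exact: sqnorm_ge0| |exact: ltW].
have -> : [set z : k.-tuple R | c <= sqnorm z] = @sqnorm R k @^-1` `[c, +oo[%classic.
  by apply/seteqP; split => z /=; rewrite in_itv/= andbT.
by rewrite -[X in measurable X]setTI; exact: measurable_sqnorm.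
Qed.

Lemma measurable_ler_const d (T : measurableType d) (f : T -> R) (c : R) :
  measurable_fun [set: T] f -> measurable [set w | c <= f w].
Proof. by move=> mf; apply: measurable_fun_le. Qed.

End Limits.

Theorem theorem3 (R : realType)
  (* for each sample size n: probability space, dimensions, design, groups *)
  (d : nat -> measure_display) (T : forall n, measurableType (d n))
  (Pr : forall n, probability (T n) R)
  (p M g s : nat -> nat)
  (X : forall n, 'M[R]_(n, p n))
  (Gr : forall n, 'I_(M n) -> {set 'I_(p n)})
  (G : forall n, {set 'I_(p n)})
  (beta : forall n, 'cV[R]_(p n))
  (sigma : nat -> R)
  (omega' : forall n, 'I_(M n) -> R)
  (PG : forall n, 'M[R]_n)
  (* noise, response and estimators, as random elements *)
  (eps y : forall n, T n -> 'cV[R]_n)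
  (binit : forall n, T n -> 'cV[R]_(p n))
  (sigmahat : forall n, T n -> R)
  (Hgroups : forall n, (0 < n)%N -> is_grouping (Gr n))
  (HG : forall n, (0 < n)%N -> G n != finset.set0)
  (Hsigma : forall n, (0 < n)%N -> 0 < sigma n)
  (Homega' : forall n k, (0 < n)%N -> 0 <= omega' n k)
  (Hmodel : forall n w, (0 < n)%N -> y n w = X n *m beta n + eps n w)
  (Heps : forall n, (0 < n)%N ->
    is_gaussian (Pr n) (eps n) ((sigma n ^+ 2)%:M))
  (Hbinit : forall n, (0 < n)%N ->
    measurable_fun [set: T n] (fun w => tuple_of_cV (binit n w)))
  (Hsigmahat : forall n, (0 < n)%N -> measurable_fun [set: T n] (sigmahat n))
  (Hsparse : forall n, (0 < n)%N ->
    strongly_group_sparse (Gr n) (g n) (s n) (beta n))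
  (Hrank : forall n, (0 < n)%N -> \rank (subcols (G n) (X n)) = #|G n|)
  (HPG : forall n, (0 < n)%N ->
    is_argmin (X n) (Gr n) (G n) (omega' n) (PG n))
  (HPG1 : forall n, (0 < n)%N ->
    spectral_norm (PG n *m (1%:M - Qtilde (X n) (Gr n) (G n))) < 1)
  (Hest : bigO_prob Pr
    (fun n w =>
       let sigmastar := norm2 (y n w - X n *m beta n) / Num.sqrt n%:R in
       `|sigmahat n w / sigmastar - 1|
       + (Num.sqrt n%:R)^-1 *
         \sum_(j < M n) omega_star n (Gr n) j / sigma n *
           norm2 (group_fit (X n) (Gr n j) (binit n w)
                  - group_fit (X n) (Gr n j) (beta n)))
    (fun n => ((s n)%:R + (g n)%:R * ln (M n)%:R) / n%:R))
  (HGn : (fun n => #|G n|%:R / n%:R : R) @ \oo --> (0 : R))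
  (Hrate : (fun n =>
      ((s n)%:R + (g n)%:R * ln (M n)%:R) / Num.sqrt n%:R *
      (Num.sqrt #|G n|%:R / Num.sqrt n%:R
       + \big[Num.max/0]_(k < M n | ~~ (Gr n k \subset G n))
           (omega' n k / omega_star n (Gr n) k)) : R) @ \oo --> (0 : R)) :
  let Xt n := Xtilde (X n) (Gr n) (G n) in
  let Qt n := Qtilde (X n) (Gr n) (G n) in
  let bhat n w := betahat (X n) (Gr n) (G n) (PG n) (y n w) (binit n w) in
  let bstar n := subvec (G n) (beta n) in
  let muhat n w := Xt n *m bhat n w in
  let mustar n := Xt n *m bstar n in
  let TG n w :=
    Tstat (X n) (Gr n) (G n) (PG n) (y n w) (binit n w) (sigmahat n w) in
  let kG n := \rank (PG n) in
  (* the n for which \hat\beta_G is defined *)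
  let full_rank := [set n | \rank (PG n *m Xt n) = #|G n|] in
  [/\ chi2_limit Pr full_rank
        (fun n t => [set w | norm2 (PG n *m Xt n *m (bhat n w - bstar n)) ^+ 2
                             <= sigmahat n w ^+ 2 * t]) kG,
      chi2_limit Pr full_rank
        (fun n t => [set w | norm2 (PG n *m Qt n *m (muhat n w - mustar n)) ^+ 2
                             <= sigmahat n w ^+ 2 * t]) kG,
      chi2_limit Pr [set n | mustar n = 0]
        (fun n t => [set w | TG n w ^+ 2 <= t]) kG,
      (forall n w, (0 < n)%N -> full_rank n ->
        (sigmahat n w)^-1 *: (PG n *m Qt n *m (muhat n w - mustar n)) =
        (sigmahat n w)^-1 *: (PG n *m Xt n *m (bhat n w - bstar n))) &
      exists xi r : forall n, T n -> 'cV[R]_n,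
        [/\ forall n, (0 < n)%N -> full_rank n ->
              is_gaussian (Pr n) (xi n) (PG n),
            forall n w, (0 < n)%N -> full_rank n ->
              (sigmahat n w)^-1 *: (PG n *m Xt n *m (bhat n w - bstar n)) =
              xi n w + r n w &
            small_prob Pr full_rank r]].
Proof.
move=> Xt Qt bhat bstar muhat mustar TG kG full_rank.
pose resp n w := corrected_response (X n) (Gr n) (G n) (y n w) (binit n w).
pose U n w := PG n *m (resp n w - Xt n *m bstar n).
pose V n w := (sigmahat n w)^-1 *: U n w.
pose xi n w := (sigma n)^-1 *: (PG n *m eps n w).
have PP n : (0 < n)%N -> PG n *m PG n = PG n by move=> /HPG[[/esym]].
have PT n : (0 < n)%N -> (PG n)^T = PG n by move=> /HPG[[_ /esym]].
have feas n : (0 < n)%N -> feasible (X n) (Gr n) (G n) (omega' n) (PG n) by move=> /HPG[].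
have rkP n : (0 < n)%N -> (kG n <= #|G n|)%N.
  by move=> n0; apply: rank_proj_le (PP n n0) (PT n n0) (HPG1 n n0).
have meps n : (0 < n)%N -> measurable_cV (eps n) by move=> /Heps[/measurable_cVP].
have mb n : (0 < n)%N -> measurable_cV (binit n) by move=> /Hbinit/measurable_cVP.
have my n : (0 < n)%N -> measurable_cV (y n).
  move=> n0; rewrite (_ : y n = fun w => X n *m beta n + eps n w).
    by apply: measurable_cVD; [exact: measurable_cV_cst|exact: meps].
  by apply/funext => w; exact: Hmodel.
have mresp n : (0 < n)%N -> measurable_cV (resp n).
  by move=> n0; apply: measurable_cV_corrected; [exact: my|exact: mb].
have mU n : (0 < n)%N -> measurable_cV (U n).
  move=> n0; apply: measurable_cVM; apply: measurable_cVB; first exact: mresp.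
  exact: measurable_cV_cst.
have msi n : (0 < n)%N -> measurable_fun [set: T n] (fun w => (sigmahat n w)^-1).
  by move=> n0; apply: (measurableT_comp measurable_inv); exact: Hsigmahat.
have mV n : (0 < n)%N -> measurable_cV (V n).
  by move=> n0; apply: measurable_cVZ; [exact: msi|exact: mU].
have mxi n : (0 < n)%N -> measurable_cV (xi n).
  move=> n0; apply: measurable_cVZ; first exact: measurable_cst.
  by apply: measurable_cVM; exact: meps.
have gxi n : (0 < n)%N -> is_gaussian (Pr n) (xi n) (PG n).
  move=> n0; have s0 := Hsigma n n0.
  have := gaussian_lin ((sigma n)^-1 *: PG n) (Heps n n0).
  rewrite (_ : _ *m _ *m _ = PG n).
    rewrite (_ : (fun w => _) = xi n)//.
    by apply/funext => w; rewrite /xi -scalemxAl.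
  rewrite -[RHS](PP n n0) mul_mx_scalar; apply/matrixP => i j; rewrite !mxE.
  apply: eq_bigr => k _; rewrite !mxE -[in X in _ = _ * X](PT n n0) [in RHS]mxE.
  by field; rewrite gt_eqF.
have geps n : (0 < n)%N -> is_gaussian (Pr n) (fun w => (sigma n)^-1 *: eps n w) 1%:M.
  move=> n0; have s0 := Hsigma n n0.
  have := gaussian_lin ((sigma n)^-1%:M) (Heps n n0).
  rewrite (_ : _ *m _ *m _ = 1%:M).
    rewrite (_ : (fun w => _) = (fun w => (sigma n)^-1 *: eps n w))//.
    by apply/funext => w; rewrite mul_scalar_mx.
  rewrite tr_scalar_mx -!scalar_mxM; congr (_%:M).
  by field; rewrite gt_eqF.
have G1 n : (0 < n)%N -> 1 <= #|G n|%:R :> R.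
  by move=> n0; rewrite ler1n card_gt0; exact: HG.
pose a n : R := ((s n)%:R + (g n)%:R * ln (M n)%:R) / n%:R.
have a0 n : 0 <= a n.
  rewrite divr_ge0// addr_ge0// mulr_ge0//.
  (* The case of no groups is covered by the value 0 of [ln] at 0. *)
  by case: (M n) => [|m]; [rewrite ln0|rewrite ln_ge0// ler1n].
pose mx n : R := \big[Num.max/0]_(k < M n | ~~ (Gr n k \subset G n))
  (omega' n k / omega_star n (Gr n) k).
have mx0 n : 0 <= mx n by exact: bigmax_ge_id.
pose Vn n w : R := `|sigmahat n w / (norm2 (y n w - X n *m beta n) / Num.sqrt n%:R) - 1|
  + (Num.sqrt n%:R)^-1 * \sum_(j < M n) omega_star n (Gr n) j / sigma n *
     norm2 (group_fit (X n) (Gr n j) (binit n w) - group_fit (X n) (Gr n j) (beta n)).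
have mVn n : (0 < n)%N -> measurable_fun [set: T n] (Vn n).
  move=> n0; apply: measurable_funD.
    apply: measurableT_comp => //; apply: measurable_funB => //.
    apply: measurable_funM; first exact: Hsigmahat.
    apply: (measurableT_comp measurable_inv); apply: measurable_funM => //.
    apply: measurable_norm2; apply: measurable_cVB; first exact: my.
    exact: measurable_cV_cst.
  apply: measurable_funM => //; apply: measurable_sum => j; apply: measurable_funM => //.
  apply: measurable_norm2; apply: measurable_cVB; last exact: measurable_cV_cst.
  by apply: measurable_group_fit; exact: mb.
(* All the limits rest on this event: off [B] the scale estimate is nonzero and the studentized
   vector is within [delta] of its Gaussian counterpart. *)
have core (e delta : R) : 0 < e -> 0 < delta -> \forall n \near \oo,
    exists B : set (T n), [/\ measurable B, (Pr n B <= e%:E)%E &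
      forall w, ~ B w -> sigmahat n w != 0 /\ norm2 (V n w - xi n w) <= delta].
  move=> e0 delta0.
  have e30 : 0 < e / 3 by rewrite divr_gt0.
  have [C C0 HC] := Hest _ e30.
  (* Markov: [|xi|^2] has mean at most [|G|], so it reaches [K^2 |G|] with probability at most
     [1 / K^2 = e / 3]. *)
  pose K := Num.sqrt (3 / e).
  have K2 : K ^+ 2 = 3 / e by rewrite sqr_sqrtr// divr_ge0// ltW.
  have K0 : 0 < K by rewrite sqrtr_gt0 divr_gt0.
  (* The scale error contributes [6 * d1 * K], which is at most [delta / 2]. *)
  pose d1 : R := Num.min (1 / 4) (delta / (12 * K)).
  have d10 : 0 < d1 by rewrite lt_min !divr_gt0// mulr_gt0.
  have d14 : d1 <= 1 / 4 by rewrite ge_min lexx.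
  have d1K : d1 * (12 * K) <= delta.
    by rewrite -ler_pdivlMr ?mulr_gt0// ge_min lexx orbT.
  (* The first bound makes the estimators' rate at most [d1 / sqrt |G|]; the second keeps the
     remainder [2 * C * rho] below [delta / 2]. *)
  pose rho : R := Num.min (d1 / C) (delta / (4 * C)).
  have rho0 : 0 < rho by rewrite lt_min !divr_gt0// mulr_gt0.
  have rho1 : rho * C <= d1 by rewrite -ler_pdivlMr// ge_min lexx.
  have rho2 : rho * (4 * C) <= delta.
    by rewrite -ler_pdivlMr ?mulr_gt0// ge_min lexx orbT.
  have tau0 : 0 < e * d1 ^+ 2 / 6 by rewrite divr_gt0// mulr_gt0// exprn_gt0.
  near=> n.
  have n0 : (0 < n)%N by near: n; exact: nbhs_infty_gt.
  have rt : `|((s n)%:R + (g n)%:R * ln (M n)%:R) / Num.sqrt n%:R *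
      (Num.sqrt #|G n|%:R / Num.sqrt n%:R + mx n)| <= rho.
    by near: n; move/cvgr0Pnorm_le : Hrate; apply.
  have nR : 0 < n%:R :> R by rewrite ltr0n.
  have sn0 : 0 < Num.sqrt n%:R :> R by rewrite sqrtr_gt0.
  have sn2 : Num.sqrt n%:R ^+ 2 = n%:R :> R by rewrite sqr_sqrtr// ltW.
  have Gn1 := G1 n n0.
  have sG1 : 1 <= Num.sqrt #|G n|%:R :> R by rewrite -[leLHS]sqrtr1; apply: ler_wsqrtr.
  set sG : R := Num.sqrt #|G n|%:R in sG1 rt.
  have sG2 : sG ^+ 2 = #|G n|%:R by rewrite sqr_sqrtr//; lra.
  have PrV : (Pr n [set w | (C * a n < `|Vn n w|)%R] <= (e / 3)%:E)%E by near: n; exact: HC.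
  have gn : `|#|G n|%:R / n%:R| <= e * d1 ^+ 2 / 6 :> R.
    by near: n; move/cvgr0Pnorm_le : HGn; apply.
  (* The rate assumption splits in two: the first term pays for the scale error times [|xi|], the
     second for the remainder. *)
  have {}rt : a n * sG + Num.sqrt n%:R * a n * mx n <= rho.
    have -> : a n * sG + Num.sqrt n%:R * a n * mx n =
        ((s n)%:R + (g n)%:R * ln (M n)%:R) / Num.sqrt n%:R *
        (sG / Num.sqrt n%:R + mx n).
      have -> : a n = ((s n)%:R + (g n)%:R * ln (M n)%:R) / Num.sqrt n%:R ^+ 2.
        by rewrite sn2.
      by field; rewrite gt_eqF.
    exact: le_trans (ler_norm _) rt.
  have asG0 : 0 <= a n * sG by apply: mulr_ge0; [exact: a0|exact: sqrtr_ge0].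
  have amx0 : 0 <= Num.sqrt n%:R * a n * mx n.
    by apply: mulr_ge0; [apply: mulr_ge0; [exact: sqrtr_ge0|exact: a0]|exact: mx0].
  (* The accuracy shrinks like [1 / sqrt |G|] to offset [|xi| <= K sqrt |G|]. Chebyshev at distance
     [n c] then costs [2 |G| / (d1^2 n)], at most [e / 3] by the choice of the bound on
     [|G| / n]. *)
  pose c := d1 / sG.
  have sG0 : 0 < sG by lra.
  have c0 : 0 < c by rewrite divr_gt0.
  have c4 : c <= 1 / 4 by rewrite ler_pdivrMr//; nra.
  have Cac : C * a n <= c.
    rewrite ler_pdivlMr// -mulrA; apply: (@le_trans _ _ (C * rho)).
      by rewrite ler_pM2l//; lra.
    by rewrite mulrC.
  pose L := K * sG.
  have L0 : 0 < L by rewrite mulr_gt0.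
  (* Failure of the estimators' bound, of [sigma^* ~ sigma], of [|xi| = O(sqrt |G|)]. *)
  pose B1 := [set w | C * a n < `|Vn n w|].
  pose B2 := [set w | n%:R * c <= `|norm2 ((sigma n)^-1 *: eps n w) ^+ 2 - n%:R|].
  pose B3 := [set w | L ^+ 2 <= norm2 (xi n w) ^+ 2].
  have mB1 : measurable B1.
    rewrite (_ : B1 = ~` [set w | `|Vn n w| <= C * a n]).
      apply/measurableC/measurable_fun_le => //.
      by apply: measurableT_comp => //; exact: mVn.
    by apply/seteqP; split => w; rewrite /B1/= ltNge => /negP.
  have meps2 : measurable_fun setT (fun w => norm2 ((sigma n)^-1 *: eps n w) ^+ 2).
    apply: measurable_funX; apply: measurable_norm2; apply: measurable_cVZ => //.
    exact: meps.
  have mB2 : measurable B2.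
    apply: measurable_ler_const; apply: measurableT_comp => //.
    exact: measurable_funB.
  have mB3 : measurable B3.
    apply: measurable_ler_const; apply: measurable_funX; apply: measurable_norm2.
    exact: mxi.
  have PB2 : (Pr n B2 <= (e / 3)%:E)%E.
    have mS : measurable [set x : R | n%:R * c <= `|x - n%:R|].
      by apply: measurable_ler_const; apply: measurableT_comp => //; exact: measurable_funB.
    have := @gaussian_proj_norm2 _ _ _ _ _ _ 1%:M _ (mulmx1 _) (trmx1 _ _) (geps n n0) mS.
    rewrite mxrank1 => E; rewrite [leLHS]E.
    apply: (le_trans (gaussian_sqnorm_chebyshev n (mulr_gt0 nR c0))); rewrite lee_fin.
    have -> : 2 * n%:R / (n%:R * c) ^+ 2 = 2 / d1 ^+ 2 * (#|G n|%:R / n%:R) :> R.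
      by rewrite /c -sG2; field; rewrite !gt_eqF.
    have h1 := le_trans (ler_norm _) gn.
    have d20 : 0 < d1 ^+ 2 by rewrite exprn_gt0.
    rewrite mulrAC ler_pdivrMr//; lra.
  have PB3 : (Pr n B3 <= (e / 3)%:E)%E.
    have mS : measurable [set x : R | L ^+ 2 <= x] by exact: measurable_ler_const.
    have E := gaussian_proj_norm2 (PP n n0) (PT n n0) (gxi n n0) mS.
    rewrite [leLHS]E.
    apply: (le_trans (gaussian_sqnorm_tail _ (exprn_gt0 _ L0))); rewrite lee_fin.
    have kk : (\rank (PG n))%:R <= #|G n|%:R :> R by rewrite ler_nat; exact: rkP.
    rewrite ler_pdivrMr ?exprn_gt0// /L exprMn sG2 K2.
    by have -> : e / 3 * (3 / e * #|G n|%:R) = #|G n|%:R by field; rewrite gt_eqF.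
  exists (B1 `|` (B2 `|` B3)); split.
  - by apply: measurableU => //; exact: measurableU.
  - have -> : e%:E = ((e / 3)%:E + ((e / 3)%:E + (e / 3)%:E))%E.
      by rewrite -!EFinD; congr EFin; field.
    apply: (le_trans (probabilityU_le _ mB1 _)); first exact: measurableU.
    apply: leeD => //; apply: (le_trans (probabilityU_le _ mB2 mB3)).
    exact: leeD.
  - move=> w /not_orP[nB1 /not_orP[nB2 nB3]].
    have h1 : Vn n w <= C * a n.
      by apply: (le_trans (ler_norm _)); rewrite leNgt; apply/negP.
    have yE : y n w - X n *m beta n = eps n w by rewrite Hmodel// addrAC subrr add0r.
    rewrite /Vn yE in h1.
    have h2 : `|norm2 ((sigma n)^-1 *: eps n w) ^+ 2 - n%:R| <= n%:R * c.
      by apply/ltW; rewrite ltNge; apply/negP.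
    have h3 : norm2 (xi n w) <= L.
      rewrite -(@ler_pXn2r _ 2)// ?nnegrE ?norm2_ge0 ?(ltW L0)//.
      by apply/ltW; rewrite ltNge; apply/negP.
    have [sh0 VX] := studentized_bound n0 (Hgroups n n0) (feas n n0) (Hsigma n n0)
      Cac c4 h1 h2 h3.
    split => //; rewrite /V /U /resp Hmodel//; apply: (le_trans VX).
    rewrite -/(mx n) /c /L.
    have -> : 6 * (d1 / sG) * (K * sG) = 6 * d1 * K by field; rewrite gt_eqF.
    have : C * (Num.sqrt n%:R * a n * mx n) <= C * rho by rewrite ler_pM2l//; lra.
    have -> : Num.sqrt n%:R * (C * a n) * mx n = C * (Num.sqrt n%:R * a n * mx n) by ring.
    lra.
have chi2E n t : (0 < n)%N ->
    chi2 (kG n) [set x | (x <= t)%R] = Pr n [set w | (norm2 (xi n w) ^+ 2 <= t)%R].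
  move=> n0; have mS : measurable [set x : R | x <= t] by exact: measurable_fun_le.
  by rewrite (gaussian_proj_norm2 (PP n n0) (PT n n0) (gxi n n0) mS).
(* Shared by the three chi-square limits. Events need to match only where [sigmahat] is nonzero,
   since its zeros lie in the exceptional set; rank 0 is asked for exactly. *)
have chi_lim (D : set nat) (E : forall n, R -> set (T n)) :
    (forall n t, (0 < n)%N -> D n -> measurable (E n t)) ->
    (forall n t w, (0 < n)%N -> D n -> sigmahat n w != 0 ->
       E n t w <-> norm2 (V n w) ^+ 2 <= t) ->
    (forall n t, (0 < n)%N -> D n -> kG n = 0%N -> E n t = [set _ | 0 <= t]) ->
    chi2_limit Pr D E kG.
  move=> mE EV E0; apply: cvg_ereal0 => e e0.
  have e20 : 0 < e / 2 by rewrite divr_gt0.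
  have [delta delta0 anti] := chi_anticoncentration e20.
  rewrite near_withinE; near=> n => Dn.
  have n0 : (0 < n)%N by near: n; exact: nbhs_infty_gt.
  have [B [mB PB HB]] : exists B : set (T n), [/\ measurable B, (Pr n B <= (e / 2)%:E)%E &
      forall w, ~ B w -> sigmahat n w != 0 /\ norm2 (V n w - xi n w) <= delta].
    by near: n; exact: core.
  apply/andP; split.
    apply: ereal_sup_ge.
    exists (`|Pr n (E n 0%R) - chi2 (kG n) [set x | (x <= 0)%R]|)%E; first by exists 0.
    exact: abse_ge0.
  apply: ge_ereal_sup => _ [t _ <-].
  (* No anticoncentration for rank 0, but then the two laws coincide. *)
  have [k0|kp] := posnP (kG n).
    rewrite (E0 n t n0 Dn k0) k0 (_ : chi2 0 _ = Pr n [set _ | 0 <= t]).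
      have fn : Pr n [set _ | 0 <= t] \is a fin_num.
        by apply: fin_num_measure; exact: measurable_fun_le.
      by rewrite subee// abse0 lee_fin ltW.
    rewrite /chi2 /pushforward/=.
    have [t0|t0] := leP 0 t.
      rewrite [X in dirac _ X](_ : _ = setT).
        rewrite diracT (_ : [set _ | _] = setT) ?probability_setT//.
        by apply/seteqP; split.
      by apply/seteqP; split => z //= _; rewrite big_ord0.
    rewrite [X in dirac _ X](_ : _ = set0).
      rewrite dirac0 (_ : [set _ | _] = set0) ?measure0//.
      by apply/seteqP; split.
    by apply/seteqP; split => z //=; rewrite big_ord0 leNgt t0.
  rewrite chi2E//.
  have -> : e%:E = (e / 2 + e / 2)%:E :> \bar R by congr EFin; field.
  apply: (@sandwich_le _ _ _ (Pr n) (fun w => norm2 (xi n w)) (fun w => norm2 (V n w))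
    _ B t delta) => //.
  - by apply: measurable_norm2; exact: mxi.
  - exact: mE.
  - by move=> w; exact: norm2_ge0.
  - by move=> w; exact: norm2_ge0.
  - by move=> w /HB[sh0 _]; exact: EV.
  - by move=> w /HB[_]; apply: le_trans; exact: norm2_dist.
  - move=> r; have mS : measurable [set x : R | r <= Num.sqrt x <= r + delta].
      rewrite (_ : [set x | _] = Num.sqrt @^-1` `[r, r + delta]%classic); last first.
        by apply/seteqP; split => x /=; rewrite in_itv.
      rewrite -[X in measurable X]setTI.
      have ms : measurable_fun [set: R] (@Num.sqrt R).
        by apply: continuous_measurable_fun; exact: sqrt_continuous.
      exact: ms.
    have := gaussian_proj_norm2 (PP n n0) (PT n n0) (gxi n n0) mS.
    rewrite (_ : [set w | _] = [set w | (r <= norm2 (xi n w) <= r + delta)%R]).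
      by move=> ->; exact: anti.
    by apply/seteqP; split => w /=; rewrite sqrtr_sqr ger0_norm ?norm2_ge0.
have UE n w : (0 < n)%N -> full_rank n ->
    PG n *m Xt n *m (bhat n w - bstar n) = U n w.
  move=> n0 fr; rewrite /U /bhat /bstar /Xt.
  exact: betahatE (PT n n0) (rkP n n0) fr _ _ _.
have VU n t w : sigmahat n w != 0 ->
    norm2 (U n w) ^+ 2 <= sigmahat n w ^+ 2 * t <-> norm2 (V n w) ^+ 2 <= t.
  move=> sh0; rewrite norm2Z exprMn real_normK ?num_real// exprVn.
  by rewrite ler_pdivrMl ?exprn_even_gt0.
(* As [G] is nonempty, full rank excludes rank 0, so the exact condition is vacuous for the first
   two limits. *)
have full_k n : (0 < n)%N -> full_rank n -> kG n = 0%N -> False.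
  move=> n0 fr k0; have : (#|G n| <= kG n)%N by rewrite -fr mxrankM_maxl.
  by rewrite k0 leqn0 cards_eq0 => /eqP G0; have := HG n n0; rewrite G0 eqxx.
have mEU n t : (0 < n)%N ->
    measurable [set w | norm2 (U n w) ^+ 2 <= sigmahat n w ^+ 2 * t].
  move=> n0; apply: measurable_fun_le.
    by apply: measurable_funX; apply: measurable_norm2; exact: mU.
  by apply: measurable_funM => //; apply: measurable_funX; exact: Hsigmahat.
have QX n w : PG n *m Qt n *m (muhat n w - mustar n) =
    PG n *m Xt n *m (bhat n w - bstar n) by exact: Qtilde_Xtilde.
have part1 : chi2_limit Pr full_rank (fun n t =>
    [set w | norm2 (PG n *m Xt n *m (bhat n w - bstar n)) ^+ 2 <= sigmahat n w ^+ 2 * t]) kG.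
  apply: chi_lim => n t.
  - move=> n0 fr; rewrite (_ : [set w | _] =
      [set w | norm2 (U n w) ^+ 2 <= sigmahat n w ^+ 2 * t]); first exact: mEU.
    by apply/seteqP; split => w /=; rewrite UE.
  - by move=> w n0 fr sh0 /=; rewrite UE//; exact: VU.
  - by move=> n0 fr /(full_k n n0 fr).
split.
- exact: part1.
- rewrite (_ : (fun n t => _) = (fun n t =>
    [set w | norm2 (PG n *m Xt n *m (bhat n w - bstar n)) ^+ 2 <= sigmahat n w ^+ 2 * t])) //.
  by apply: functional_extensionality_dep => n; apply/funext => t; under eq_set do rewrite QX.
- have TE n w : mustar n = 0 -> TG n w ^+ 2 = norm2 (V n w) ^+ 2.
    move=> m0; rewrite /V /U (_ : Xt n *m bstar n = 0)// subr0 norm2Z.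
    by rewrite !exprMn real_normK ?num_real.
  apply: chi_lim => n t.
  + move=> n0 /= m0; rewrite (_ : [set w | _] = [set w | norm2 (V n w) ^+ 2 <= t]).
      apply: measurable_fun_le => //.
      by apply: measurable_funX; apply: measurable_norm2; exact: mV.
    by apply/seteqP; split => w /=; rewrite TE.
  + by move=> w n0 /= m0 _; rewrite TE.
  (* Rank 0 is possible here; then [T_G] vanishes identically, as does a chi-square variable without
     degrees of freedom. *)
  + move=> n0 /= m0 k0; have P0 : PG n = 0 by apply/eqP; rewrite -mxrank_eq0 -/(kG n) k0.
    apply/seteqP; split => w /=;
      by rewrite /TG /Tstat P0 mul0mx norm20 mulr0 expr0n.
- by move=> n w n0 fr; rewrite QX.
- exists xi, (fun n w => V n w - xi n w); split.
  + by move=> n n0 _; exact: gxi.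
  + by move=> n w n0 fr; rewrite UE// [RHS]addrC subrK.
  + move=> e e0; apply: cvg_ereal0 => e' e'0.
    (* The event is [e <= norm2 r], so the error has to stay strictly below [e]. *)
    have e20 : 0 < e / 2 by rewrite divr_gt0.
    rewrite near_withinE; near=> n => _.
    have n0 : (0 < n)%N by near: n; exact: nbhs_infty_gt.
    have [B [mB PB HB]] : exists B : set (T n), [/\ measurable B, (Pr n B <= e'%:E)%E &
        forall w, ~ B w -> sigmahat n w != 0 /\ norm2 (V n w - xi n w) <= e / 2].
      by near: n; exact: core.
    rewrite measure_ge0/=; apply: le_trans PB; apply: le_measure; rewrite ?inE//.
      apply: measurable_ler_const; apply: measurable_norm2; apply: measurable_cVB.
        exact: mV.
      exact: mxi.
    move=> w /= ew; apply: contrapT => /HB[_]; lra.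
Unshelve. all: by end_near. Qed.
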